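(* Let $\Omega\subseteq\mathbb{R}^d$ be a compact convex set with non-empty interior $\Omega^\circ$. Let $\mu_0,\mu_1$ have Lebesgue densities $p_0,p_1$ supported on $\Omega$ which are continuous, uniformly bounded, and bounded away from zero on $\Omega$. Define, for $\eta\in[0,\mathrm{diam}(\Omega)]$, $$\omega(\eta)=\sup_{z,z'\in\Omega,\ \|z-z'\|\le\eta}\max\Big\{\Big|\frac{p_0(z)}{p_0(z')}-1\Big|,\Big|\frac{p_1(z)}{p_1(z')}-1\Big|\Big\},$$ and assume that $\eta\mapsto\omega(\eta)+\eta$ is non-decreasing and that $\Psi(u)=\int\frac{du}{u+\omega(u)}$ (an indefinite integral) satisfies $\Psi(\varepsilon)\to-\infty$ as $\varepsilon\to0$. For $t\in(0,1)$ and $z\in\Omega^\circ$ let $$v(t,z)=\frac{\int_{S_t(z)}\delta\,p_0(z-t\delta)p_1(z+(1-t)\delta)\,d\delta}{\int_{S_t(z)}p_0(z-t\delta)p_1(z+(1-t)\delta)\,d\delta},\qquad S_t(z)=\{\delta\in\mathbb{R}^d: z-t\delta\in\Omega,\ z+(1-t)\delta\in\Omega\}.$$ Then for every $x\in\Omega^\circ$ there exists a unique Carathéodory solution of the rectified flow equation started at $x$, i.e. a unique function $z:[0,1]\to\Omega$ with $z(s)\in\Omega^\circ$ for $s\in[0,1)$ such that $$z(t)=x+\int_0^tv(s,z(s))\,ds\quad\text{for all }t\in[0,1].$$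
   Context: $v(t,z)$ equals $\mathbb{E}[X_1-X_0\mid (1-t)X_0+tX_1=z]$ for independent $X_0\sim\mu_0$, $X_1\sim\mu_1$; it is not defined on $\partial\Omega$, which is why solutions are required to stay in $\Omega^\circ$ before time $1$. *)

(* Defs.v *)
From HB Require Import structures.
From mathcomp Require Import all_boot all_order all_algebra.
From mathcomp Require Import all_classical all_reals all_analysis.
Set Implicit Arguments. Unset Strict Implicit. Unset Printing Implicit Defensive.
Import Order.TTheory GRing.Theory Num.Theory.
Import numFieldNormedType.Exports.
Local Open Scope classical_set_scope.
Local Open Scope ring_scope.

Definition enorm {R : realType} {d : nat} (z : 'rV[R]_d) : R :=
  Num.sqrt (\sum_(i < d) z 0 i ^+ 2).

Definition diam {R : realType} {d : nat} (Om : set 'rV[R]_d) : R :=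
  sup [set enorm (z - z') | z in Om & z' in Om].

Definition convex_set_rV {R : realType} {d : nat} (Om : set 'rV[R]_d) : Prop :=
  forall x y, Om x -> Om y -> forall t : R, 0 <= t <= 1 ->
    Om ((1 - t) *: x + t *: y).

Definition vcons {R : realType} {d : nat} (x : R) (y : 'rV[R]_d) : 'rV[R]_d.+1 :=
  \row_(i < d.+1) match unlift ord0 i with Some j => y 0 j | None => x end.

(* Lebesgue integral over R^d, computed as the iterated one-dimensional
   Lebesgue integral (Fubini); used only for bounded compactly supported
   Borel integrands below. *)
Fixpoint lint {R : realType} (d : nat) : ('rV[R]_d -> R) -> R :=
  match d with
  | 0 => fun f => f 0
  | d'.+1 => fun f =>
      Rintegral (@lebesgue_measure R) setT (fun x => lint (fun y => f (vcons x y)))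
  end.

Definition lint_on {R : realType} (d : nat) (D : set 'rV[R]_d)
  (f : 'rV[R]_d -> R) : R := lint (fun x => \1_D x * f x).

Definition omega {R : realType} {d : nat} (Om : set 'rV[R]_d)
  (p0 p1 : 'rV[R]_d -> R) (eta : R) : R :=
  sup [set r : R | exists z z' : 'rV[R]_d, [/\ Om z, Om z', enorm (z - z') <= eta &
        r = Num.max `|p0 z / p0 z' - 1| `|p1 z / p1 z' - 1| ] ].

Definition Sset {R : realType} {d : nat} (Om : set 'rV[R]_d) (t : R)
  (z : 'rV[R]_d) : set 'rV[R]_d :=
  [set delta | Om (z - t *: delta) /\ Om (z + (1 - t) *: delta)].

Definition vfield {R : realType} {d : nat} (Om : set 'rV[R]_d)
  (p0 p1 : 'rV[R]_d -> R) (t : R) (z : 'rV[R]_d) : 'rV[R]_d :=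
  \row_(i < d)
    (lint_on (Sset Om t z)
       (fun delta => delta 0 i * p0 (z - t *: delta) * p1 (z + (1 - t) *: delta))
     / lint_on (Sset Om t z)
       (fun delta => p0 (z - t *: delta) * p1 (z + (1 - t) *: delta))).

Definition cara_solution {R : realType} {d : nat} (Om : set 'rV[R]_d)
  (p0 p1 : 'rV[R]_d -> R) (x : 'rV[R]_d) (z : R -> 'rV[R]_d) : Prop :=
  [/\ (forall s, 0 <= s <= 1 -> Om (z s)),
      (forall s, 0 <= s < 1 -> (interior Om) (z s)),
      (forall i : 'I_d, (@lebesgue_measure R).-integrable `[0, 1]
          (fun s => ((vfield Om p0 p1 s (z s)) 0 i)%:E)) &
      (forall t, 0 <= t <= 1 ->
          z t = x + \row_(i < d) Rintegral (@lebesgue_measure R) `[0, t]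
                      (fun s => (vfield Om p0 p1 s (z s)) 0 i))].

(* Main.v *)
Require Import Defs.
From HB Require Import structures.
From mathcomp Require Import all_boot all_order all_algebra.
From mathcomp Require Import all_classical all_reals all_analysis.
From mathcomp Require Import measurable_realfun.
From mathcomp Require Import ring lra.
Import Order.TTheory GRing.Theory Num.Theory.
Import numFieldNormedType.Exports.
Local Open Scope classical_set_scope.
Local Open Scope ring_scope.
Set Implicit Arguments. Unset Strict Implicit. Unset Printing Implicit Defensive.
(** Write [x0], [x1] for the endpoints and [delta = x1 - x0], so that [v(t, z)] is the mean of
    [delta] under the density [p0 (z - t delta) p1 (z + (1 - t) delta)].

    Regularity: contracting a pair of endpoints by a factor [1 - lam] towards a common point of
    [Om] maps the fiber [S_t(z)] into the fiber [S_t'(z')], provided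
    [|z - z'| + D |t - t'| <= lam rho] where [rho] bounds from below the distance of [z'] to the
    complement of [Om] and [D = diam Om].  This multiplies the densities by at least
    [(1 - omega (lam D))^2], so comparing the integrals in both directions gives
    [|v(t, z) - v(t', z')| <= K(lam) = O(lam + omega (lam D))], with no blow-up as [t] tends to
    [0] or [1].

    Confinement: [z + (1 - t) v(t, z)] is a mean of points of [Om], so an Euler step is a convex
    combination of the current point with a point of [Om], and the ball of radius [(1 - t) r]
    around the Euler scheme stays in [Om] if the ball of radius [r] around the start is.

    Existence follows by taking the limit of Euler step functions along an ultrafilter.  For
    uniqueness, the Osgood condition is used in dyadic form: the distance of two solutions needs
    time of order [s_j / (s_j + omega s_j)], with [s_j = D / 2^j], to double between successive
    levels, and these times have a divergent sum. *)

(** * Iterated integrals *)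

Section IteratedIntegral.
Context {R : realType}.
Notation mu := (@lebesgue_measure R).

(* Joint measurability on [T * R^d], peeling off the coordinates of [R^d] in the same order as
   [lint] does, so that no sigma-algebra on ['rV_d] is needed. *)
Fixpoint lmeas (d : nat) : forall disp (T : measurableType disp),
    (T -> 'rV[R]_d -> R) -> Prop :=
  match d return forall disp (T : measurableType disp), (T -> 'rV[R]_d -> R) -> Prop with
  | 0 => fun _ T f => measurable_fun setT (fun x => f x 0)
  | d'.+1 => fun _ T f =>
      lmeas (T := (T * measurableTypeR R)%type) (fun xr y => f xr.1 (vcons xr.2 y))
  end.

Lemma lmeas_cst d disp (T : measurableType disp) (h : T -> R) :
  measurable_fun setT h -> lmeas (fun x (_ : 'rV_d) => h x).
Proof.
elim: d disp T h => [//|d IH] disp T h mh /=.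
by apply: (IH _ (T * measurableTypeR R)%type (h \o fst)); exact: measurableT_comp.
Qed.

Lemma lmeasD d disp (T : measurableType disp) (f g : T -> 'rV_d -> R) :
  lmeas f -> lmeas g -> lmeas (fun x y => f x y + g x y).
Proof.
elim: d disp T f g => [|d IH] disp T f g /=; first exact: measurable_funD.
by move=> mf mg; exact: (IH _ _ _ _ mf mg).
Qed.

Lemma lmeasM d disp (T : measurableType disp) (f g : T -> 'rV_d -> R) :
  lmeas f -> lmeas g -> lmeas (fun x y => f x y * g x y).
Proof.
elim: d disp T f g => [|d IH] disp T f g /=; first exact: measurable_funM.
by move=> mf mg; exact: (IH _ _ _ _ mf mg).
Qed.

Lemma lmeas_precomp d disp (T : measurableType disp) disp' (T' : measurableType disp')
    (phi : T' -> T) (f : T -> 'rV_d -> R) :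
  measurable_fun setT phi -> lmeas f -> lmeas (fun x => f (phi x)).
Proof.
elim: d disp T disp' T' phi f => [|d IH] disp T disp' T' phi f /= mphi mf.
  exact: (measurableT_comp mf mphi).
apply: (IH _ _ _ _ (fun xr : T' * measurableTypeR R => (phi xr.1, xr.2)) _ _ mf).
by apply: measurable_fun_pair => //=; exact: measurableT_comp.
Qed.

Lemma vconsE d (r : R) (y : 'rV_d) i : vcons r y 0 i = oapp (y 0) r (unlift ord0 i).
Proof. by rewrite mxE; case: unlift. Qed.

Lemma lmeas_coord d disp (T : measurableType disp) (i : 'I_d) :
  lmeas (fun (_ : T) (y : 'rV_d) => y 0 i).
Proof.
elim: d disp T i => [|d IH] disp T; first by case.
move=> i /=; under [X in lmeas X]eq_fun do under eq_fun do rewrite vconsE.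
case: unliftP => [j _|_] /=; first exact: IH.
exact: lmeas_cst.
Qed.

(** [F] is tested against maps from every measurable type because the induction on [d] replaces [T]
    by [T * R] at each coordinate. *)
Lemma lmeas_comp n (F : 'rV[R]_n -> R) :
  (forall disp (T : measurableType disp) (phi : T -> 'rV[R]_n),
    (forall i, measurable_fun setT (fun x => phi x 0 i)) ->
    measurable_fun setT (F \o phi)) ->
  forall d disp (T : measurableType disp) (Phi : T -> 'rV[R]_d -> 'rV[R]_n),
  (forall i, lmeas (fun x y => Phi x y 0 i)) -> lmeas (fun x y => F (Phi x y)).
Proof.
move=> mF; elim=> [|d IH] disp T Phi mPhi /=; first exact: (mF _ _ (Phi^~ 0)).
exact: IH.
Qed.

(** Tonelli handles the integrals of the positive and the negative part separately; the inner
    integrals are covered by induction, with [T] enlarged by one coordinate. *)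
Lemma measurable_lint d disp (T : measurableType disp) (f : T -> 'rV_d -> R) :
  lmeas f -> measurable_fun setT (fun x => lint (f x)).
Proof.
elim: d disp T f => [//|d IH] disp T f /= mf.
pose F (xr : T * measurableTypeR R) := (lint (fun y => f xr.1 (vcons xr.2 y)))%:E.
have mF : measurable_fun setT F by apply/measurable_EFinP; exact: (IH _ _ _ mf).
rewrite /Rintegral; apply: measurableT_comp => //=.
under eq_fun do rewrite integralE.
apply: emeasurable_funB.
- rewrite [X in measurable_fun _ X](_ : _ = fubini_F mu F^\+%E).
    by apply: measurable_fun_fubini_tonelli_F => //; exact: measurable_funepos.
  by apply/funext => x; apply: eq_integral => r _; rewrite !funeposE.
- rewrite [X in measurable_fun _ X](_ : _ = fubini_F mu F^\-%E).
    by apply: measurable_fun_fubini_tonelli_F => //; exact: measurable_funeneg.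
  by apply/funext => x; apply: eq_integral => r _; rewrite !funenegE.
Qed.

Lemma bounded_integrable_itv (a b M : R) (g : R -> R) :
  measurable_fun `[a, b] g -> (forall x, a <= x <= b -> `|g x| <= M) ->
  mu.-integrable `[a, b] (EFin \o g).
Proof.
move=> mg gM; apply: measurable_bounded_integrable => //.
- by rewrite /= lebesgue_measure_itv /=; case: ifPn => // _; rewrite -EFinB ltry.
- exists M; split; rewrite ?num_real // => x Mx y /=; rewrite in_itv /= => yab.
  exact: le_trans (gM _ yab) (ltW Mx).
Qed.

Lemma le_normr_Rintegral_itv (a b M : R) (g : R -> R) : a <= b ->
  mu.-integrable `[a, b] (EFin \o g) -> (forall x, a <= x <= b -> `|g x| <= M) ->
  `|\int[mu]_(x in `[a, b]) g x| <= M * (b - a).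
Proof.
move=> ab ig gM; apply: (le_trans (le_normr_Rintegral _ ig)) => //.
apply: (@le_trans _ _ (\int[mu]_(x in `[a, b]) M)).
  apply: le_Rintegral => //.
  - exact: (integrable_norm ig).
  - apply: (bounded_integrable_itv (M := `|M|)) => //.
rewrite Rintegral_cst //= lebesgue_measure_itv /= lte_fin.
by move: ab; rewrite le_eqVlt => /orP[/eqP ->|->] //=; rewrite ltxx subrr.
Qed.

Lemma bounded_support_integrable (B M : R) (g : R -> R) :
  measurable_fun setT g -> (forall x, `|g x| <= M) ->
  (forall x, B < `|x| -> g x = 0) ->
  mu.-integrable setT (EFin \o g) /\
  \int[mu]_x g x = \int[mu]_(x in `[- B, B]) g x.
Proof.
move=> mg gM g0.
have gE : g = g \_ `[- B, B].
  apply/funext => x; rewrite patchE; case: ifPn => // /negP xB.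
  by apply: g0; rewrite ltNge ler_norml; apply/negP => xB'; apply: xB; rewrite inE /= in_itv.
split; last by rewrite [RHS]Rintegral_mkcond -gE.
rewrite gE -restrict_EFin.
have := @integrable_mkcond _ _ R mu `[- B, B]%classic (EFin \o g)
  (measurable_itv _).
move=> [+ _]; apply.
apply: (bounded_integrable_itv (M := M)) => //; exact: measurable_funTS.
Qed.

(** Class of integrands for which every partial integral in [lint] is again bounded with bounded
    support, hence integrable. One [B] bounds both the values and the coordinates of the support. *)
Definition lgood d (f : 'rV[R]_d -> R) :=
  lmeas (fun _ : unit => f) /\
  exists B : R, [/\ 0 <= B, forall y, `|f y| <= B &
    forall (y : 'rV[R]_d) i, B < `|y 0 i| -> f y = 0].

Lemma vcons0 d (r : R) (y : 'rV[R]_d) : vcons r y 0 ord0 = r.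
Proof. by rewrite vconsE unlift_none. Qed.

Lemma vconsS d (r : R) (y : 'rV[R]_d) i : vcons r y 0 (lift ord0 i) = y 0 i.
Proof. by rewrite vconsE liftK. Qed.

Lemma lmeas_section d (f : 'rV[R]_d.+1 -> R) :
  lmeas (fun _ : unit => f) -> lmeas (fun (r : measurableTypeR R) y => f (vcons r y)).
Proof.
move=> /= mf; apply: (lmeas_precomp (phi := fun r : measurableTypeR R => (tt, r)) _ mf).
exact: measurable_fun_pair.
Qed.

Lemma lgood_section d (f : 'rV[R]_d.+1 -> R) r :
  lgood f -> lgood (fun y => f (vcons r y)).
Proof.
move=> [mf [B [B0 fB f0]]]; split.
  exact: (lmeas_precomp (phi := fun _ : unit => (r : measurableTypeR R)) _ (lmeas_section mf)).
exists B; split => // y i yi; apply: (f0 _ (lift ord0 i)).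
by rewrite vconsS.
Qed.

Lemma lint0 d : lint (fun _ : 'rV[R]_d => 0) = 0.
Proof.
elim: d => [//|d IH] /=.
by rewrite IH Rintegral_cst //= mul0r.
Qed.

Lemma lint_le_bound d (f : 'rV[R]_d -> R) (M B : R) : lmeas (fun _ : unit => f) ->
  0 <= B -> (forall y, `|f y| <= M) -> (forall (y : 'rV[R]_d) i, B < `|y 0 i| -> f y = 0) ->
  `|lint f| <= M * (B + B) ^+ d.
Proof.
elim: d f => [|d IH] f mf B0 fM f0 /=; first by rewrite mulr1.
have bd r : `|lint (fun y => f (vcons r y))| <= M * (B + B) ^+ d.
  apply: IH => //.
    exact: (lmeas_precomp (phi := fun _ : unit => (r : measurableTypeR R)) _ (lmeas_section mf)).
  by move=> y i yi; apply: (f0 _ (lift ord0 i)); rewrite vconsS.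
have [|ig ->] := @bounded_support_integrable B (M * (B + B) ^+ d)
  (fun r => lint (fun y => f (vcons r y))) (measurable_lint (lmeas_section mf)) bd.
  move=> r rB; rewrite -[RHS](lint0 d); congr lint; apply/funext => y.
  by apply: (f0 _ ord0); rewrite vcons0.
have BB : - B <= B by rewrite ge0_cp.
have := @le_normr_Rintegral_itv (- B) B (M * (B + B) ^+ d) _ BB _ (fun x _ => bd x).
rewrite opprK exprSr mulrA; apply.
exact: (integrableS measurableT _ _ ig).
Qed.

Lemma lgood_integrable d (f : 'rV[R]_d.+1 -> R) : lgood f ->
  mu.-integrable setT (EFin \o (fun r => lint (fun y => f (vcons r y)))).
Proof.
move=> gf; have [mf [B [B0 fB f0]]] := gf.
apply: (proj1 (@bounded_support_integrable B (B * (B + B) ^+ d)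
  (fun r => lint (fun y => f (vcons r y))) (measurable_lint (lmeas_section mf)) _ _)).
  move=> r; apply: lint_le_bound => //; first by have [] := lgood_section r gf.
  by move=> y i yi; apply: (f0 _ (lift ord0 i)); rewrite vconsS.
move=> r rB; rewrite -[RHS](lint0 d); congr lint; apply/funext => y.
by apply: (f0 _ ord0); rewrite vcons0.
Qed.

Lemma lgoodD d (f g : 'rV[R]_d -> R) : lgood f -> lgood g -> lgood (fun y => f y + g y).
Proof.
move=> [mf [B [B0 fB f0]]] [mg [C [C0 gC g0]]]; split; first exact: lmeasD.
exists (B + C); split; first exact: addr_ge0.
  by move=> y; exact: le_trans (ler_normD _ _) (lerD _ _).
by move=> y i yi; rewrite (f0 _ i) ?(g0 _ i) ?addr0 // (le_lt_trans _ yi) // ?lerDl ?lerDr.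
Qed.

Lemma lgoodZ d (c : R) (f : 'rV[R]_d -> R) : lgood f -> lgood (fun y => c * f y).
Proof.
move=> [mf [B [B0 fB f0]]]; split.
  by apply: (lmeasM (f := fun _ _ => c)) => //; exact: lmeas_cst.
exists (B + `|c| * B); split; first by rewrite addr_ge0 // mulr_ge0.
  by move=> y; rewrite normrM ler_wpDl // ler_wpM2l.
move=> y i yi; rewrite (f0 _ i) ?mulr0 // (le_lt_trans _ yi) // lerDl mulr_ge0 //.
Qed.

Lemma lintD d (f g : 'rV[R]_d -> R) : lgood f -> lgood g ->
  lint (fun y => f y + g y) = lint f + lint g.
Proof.
elim: d f g => [//|d IH] f g gf gg /=.
rewrite -RintegralD ?lgood_integrable //=.
congr Rintegral; apply/funext => r; apply: IH; exact: lgood_section.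
Qed.

Lemma lintZ d (c : R) (f : 'rV[R]_d -> R) : lgood f ->
  lint (fun y => c * f y) = c * lint f.
Proof.
elim: d f => [//|d IH] f gf /=.
rewrite -RintegralZl ?lgood_integrable //=.
congr Rintegral; apply/funext => r; apply: IH; exact: lgood_section.
Qed.

Lemma le_lint d (f g : 'rV[R]_d -> R) : lgood f -> lgood g ->
  (forall y, f y <= g y) -> lint f <= lint g.
Proof.
elim: d f g => [|d IH] f g gf gg fg /=; first exact: fg.
apply: le_Rintegral => //; try exact: lgood_integrable.
move=> r _; apply: IH => //; exact: lgood_section.
Qed.

Lemma lint_ge0 d (f : 'rV[R]_d -> R) : (forall y, 0 <= f y) -> 0 <= lint f.
Proof.
elim: d f => [|d IH] f f0 /=; first exact: f0.
by apply: Rintegral_ge0 => r _; exact: IH.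
Qed.

(** By uniqueness of Lebesgue measure: [c] times the image of [mu] under multiplication by [c] gives
    each interval []a, b]] its length. *)
Lemma lebesgue_measure_dilation (c : R) (A : set R) : 0 < c -> measurable A ->
  mu ( *%R c @^-1` A) = (c^-1%:E * mu A)%E.
Proof.
move=> c0 mA.
pose cn : {nonneg R} := NngNum (ltW c0).
have mc : measurable_fun setT ( *%R c : measurableTypeR R -> measurableTypeR R).
  exact: mulrl_measurable.
pose nu : {measure set (measurableTypeR R) -> \bar R} :=
  mscale cn (pushforward mu ( *%R c : measurableTypeR R -> measurableTypeR R)).
suff -> : (mu A = nu mc A)%E.
  by rewrite /nu /mscale /= muleA -EFinM mulVf ?gt_eqF // mul1e.
apply: lebesgue_measure_unique => // _ [[a b]] _ <-.
change (mu `]a, b] = c%:E * mu ( *%R c @^-1` `]a, b]))%E.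
have -> : ( *%R c @^-1` `]a, b] = `](a / c), (b / c)])%classic.
  by apply/seteqP; split => x /=; rewrite !in_itv /= ltr_pdivrMr // ler_pdivlMr // (mulrC x).
rewrite !lebesgue_measure_itv /= !lte_fin ltr_pM2r ?invr_gt0 //.
case: ifPn => _; last by rewrite mule0.
by rewrite -!EFinB -EFinM -mulrBl mulrCA divff ?gt_eqF // mulr1.
Qed.

Lemma Rintegral_dilation (c : R) (f : R -> R) : 0 < c -> measurable_fun setT f ->
  (forall r, 0 <= f r) -> \int[mu]_r f (c * r) = c^-1 * \int[mu]_r f r.
Proof.
move=> c0 mf f0; rewrite /Rintegral.
have ci : 0 <= c^-1 by rewrite invr_ge0 ltW.
have mEf : measurable_fun setT (EFin \o f) by exact/measurable_EFinP.
have mc : measurable_fun setT ( *%R c : measurableTypeR R -> measurableTypeR R).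
  exact: mulrl_measurable.
have -> : (\int[mu]_r (f (c * r))%:E = (c^-1)%:E * \int[mu]_r (f r)%:E)%E.
  have := @ge0_integral_pushforward _ _ _ _ R _ mc mu setT (EFin \o f) measurableT mEf
    (fun y _ => f0 y).
  rewrite preimage_setT /= => <-.
  rewrite -(@ge0_integral_mscale _ _ R mu setT measurableT (NngNum ci)) //.
    by apply: eq_measure_integral => A mA _; exact: lebesgue_measure_dilation.
  by move=> x _; rewrite lee_fin.
(* The integral may be [+oo]; both real integrals are then 0, the value of [fine] at infinity. *)
have : (0 <= \int[mu]_r (f r)%:E)%E by apply: integral_ge0 => x _; rewrite lee_fin.
case: (\int[mu]_r (f r)%:E)%E => [r||] //= _.
by rewrite gt0_muley ?lte_fin ?invr_gt0 //= mulr0.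
Qed.

Lemma vconsZ d (c r : R) (y : 'rV[R]_d) : c *: vcons r y = vcons (c * r) (c *: y).
Proof. by apply/rowP => i; rewrite mxE !vconsE; case: unlift => //= j; rewrite mxE. Qed.

Lemma lint_dilation d (c : R) (f : 'rV[R]_d -> R) : 0 < c -> lgood f ->
  (forall y, 0 <= f y) -> lint (fun y => f (c *: y)) = c^-1 ^+ d * lint f.
Proof.
elim: d f => [|d IH] f c0 gf f0 /=; first by rewrite mul1r scaler0.
have gs r := lgood_section r gf.
transitivity (\int[mu]_r (c^-1 ^+ d * lint (fun y => f (vcons (c * r) y)))).
  congr Rintegral; apply/funext => r; rewrite -IH //.
  by congr lint; apply/funext => y; rewrite vconsZ.
rewrite (Rintegral_dilation (f := fun r => c^-1 ^+ d * lint (fun y => f (vcons r y)))) //.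
- by rewrite RintegralZl ?lgood_integrable // exprS mulrA.
- apply: measurable_funM => //; exact: (measurable_lint (lmeas_section gf.1)).
- by move=> r; rewrite mulr_ge0 ?exprn_ge0 ?invr_ge0 ?(ltW c0) // lint_ge0.
Qed.

(** Indicator of the closed sup-norm ball of radius [rho]; the product form follows the
    coordinatewise recursion of [lint]. *)
Definition cube d (rho : R) (y : 'rV[R]_d) : R := \prod_i \1_`[- rho, rho] (y 0 i).

Lemma cube_vcons d (rho : R) r (y : 'rV[R]_d) :
  cube rho (vcons r y) = \1_`[- rho, rho] r * cube rho y.
Proof.
rewrite /cube big_ord_recl vcons0; congr (_ * _).
by apply: eq_bigr => i _; rewrite vconsS.
Qed.

Lemma lmeas_prod d disp (T : measurableType disp) (I : Type) (s : seq I)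
    (f : I -> T -> 'rV[R]_d -> R) :
  (forall i, lmeas (f i)) -> lmeas (fun x y => \prod_(i <- s) f i x y).
Proof.
move=> mf; elim: s => [|i s IH].
  under [X in lmeas X]eq_fun do under eq_fun do rewrite big_nil.
  exact: lmeas_cst.
under [X in lmeas X]eq_fun do under eq_fun do rewrite big_cons.
exact: lmeasM.
Qed.

Lemma lmeas_comp1 d disp (T : measurableType disp) (h : R -> R) (f : T -> 'rV[R]_d -> R) :
  measurable_fun setT h -> lmeas f -> lmeas (fun x y => h (f x y)).
Proof.
move=> mh; elim: d disp T f => [|d IH] disp T f /= mf; first exact: measurableT_comp.
exact: (IH _ _ _ mf).
Qed.

Lemma cubeE d (rho : R) (y : 'rV[R]_d) : cube rho y = [forall i, `|y 0 i| <= rho]%:R.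
Proof.
rewrite /cube; case: forallP => [yr|/forallP].
  by apply: big1 => i _; rewrite indicE mem_set //= in_itv /= -ler_norml.
rewrite negb_forall => /existsP[i yi]; apply/eqP; rewrite prodf_seq_eq0.
apply/hasP; exists i; first exact: mem_index_enum.
rewrite /= indicE memNset //= in_itv /= -ler_norml; exact/negP.
Qed.

Lemma lgood_cube d (rho : R) : 0 <= rho -> lgood (@cube d rho).
Proof.
move=> r0; split.
  apply: lmeas_prod => i; apply: lmeas_comp1; last exact: lmeas_coord.
  exact: measurable_indic.
exists (rho + 1); split; first by rewrite addr_ge0.
  move=> y; rewrite cubeE ger0_norm // (@le_trans _ _ 1) ?lerDr //.
  by rewrite lern1 leq_b1.
move=> y i yi; rewrite cubeE; case: forallP => // /(_ i).
by rewrite leNgt (lt_trans _ yi) // ltrDl.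
Qed.

Lemma lint_cube d (rho : R) : 0 <= rho -> lint (@cube d rho) = (rho + rho) ^+ d.
Proof.
move=> r0; elim: d => [|d IH] /=; first by rewrite /cube big_ord0.
transitivity (\int[mu]_r ((rho + rho) ^+ d * \1_`[- rho, rho] r)).
  congr Rintegral; apply/funext => r; rewrite mulrC -IH.
  under [X in lint X]eq_fun do rewrite cube_vcons.
  by rewrite lintZ //; exact: lgood_cube.
rewrite RintegralZl //.
  rewrite exprSr; congr (_ * _); rewrite /Rintegral integral_indic //= setIT.
  by rewrite lebesgue_measure_itv /= lte_fin; case: ltP => /=; lra.
apply: (@bounded_support_integrable rho 1 _ _ _ _).1.
- exact: measurable_indic.
- by move=> x; rewrite ger0_norm indicE ?lern1 ?leq_b1.
- move=> x xr; rewrite indicE memNset //= in_itv /= -ler_norml.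
  by rewrite leNgt xr.
Qed.

Lemma lmeas_dilation n disp (T : measurableType disp) (k : R) (f : T -> 'rV[R]_n -> R) :
  lmeas f -> lmeas (fun x y => f x (k *: y)).
Proof.
elim: n disp T f => [|n IH] disp T f /= mf; first by under eq_fun do rewrite scaler0.
under [X in lmeas X]eq_fun do under eq_fun do rewrite vconsZ.
have mphi : measurable_fun setT (fun xr : T * measurableTypeR R => (xr.1, k * xr.2)).
  by apply: measurable_fun_pair => //=; apply: (measurable_funM (f := fun=> k)).
exact: (lmeas_precomp (f := fun (xr : T * measurableTypeR R) y => f xr.1 (vcons xr.2 (k *: y)))
  mphi (IH _ _ _ mf)).
Qed.

Lemma lgood_dilation n (k : R) (f : 'rV[R]_n -> R) : 0 < k -> lgood f ->
  lgood (fun y => f (k *: y)).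
Proof.
move=> k0 [mf [B [B0 fB f0]]]; split; first exact: (lmeas_dilation k mf).
exists (B + B / k); split => //.
- by rewrite addr_ge0 // divr_ge0 // ltW.
- by move=> y; rewrite (le_trans (fB _)) // lerDl divr_ge0 // ltW.
move=> y i yi; apply: (f0 _ i); rewrite mxE normrM gtr0_norm // mulrC -ltr_pdivrMr //.
by rewrite (le_lt_trans _ yi) // lerDr.
Qed.

Lemma lgood_coordM d (f : 'rV[R]_d -> R) i : lgood f -> lgood (fun y => y 0 i * f y).
Proof.
move=> [mf [B [B0 fB f0]]]; split.
  by apply: (lmeasM (f := fun _ y => y 0 i)) => //; exact: lmeas_coord.
exists (B + B * B); split; first by rewrite addr_ge0 // mulr_ge0.
  move=> y; have [yB|By] := leP `|y 0 i| B.
    by rewrite normrM ler_wpDl // ler_pM.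
  by rewrite (f0 _ _ By) mulr0 normr0 addr_ge0 // mulr_ge0.
by move=> y j yj; rewrite (f0 _ j) ?mulr0 // (le_lt_trans _ yj) // lerDl mulr_ge0.
Qed.

Lemma lgood_sum d (I : Type) (s : seq I) (f : I -> 'rV[R]_d -> R) :
  (forall i, lgood (f i)) ->
  lgood (fun y => \sum_(i <- s) f i y) /\
  lint (fun y => \sum_(i <- s) f i y) = \sum_(i <- s) lint (f i).
Proof.
move=> gf; elim: s => [|i s [IH1 IH2]].
  under eq_fun do rewrite big_nil; rewrite big_nil lint0; split => //.
  split; first exact: lmeas_cst.
  by exists 0; split => // y; rewrite normr0.
under eq_fun do rewrite big_cons; rewrite big_cons lintD // -IH2; split => //.
exact: lgoodD.
Qed.

End IteratedIntegral.

(** * Norms, measurability and real functions *)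

Section Space.
Context {R : realType}.
Notation mu := (@lebesgue_measure R).

(** * Sup norm and Euclidean norm on row vectors *)

Section Norms.
Context {d : nat}.
Implicit Types z : 'rV[R]_d.

Lemma rV_norm_coord z i : `|z 0 i| <= `|z|.
Proof.
rewrite [leRHS]/Num.Def.normr /= mx_normrE.
by apply/bigmax_geP; right; exists (0, i).
Qed.

Lemma rV_norm_le z e : 0 <= e -> (forall i, `|z 0 i| <= e) -> `|z| <= e.
Proof.
move=> e0 ze; rewrite [leLHS]/Num.Def.normr /= mx_normrE.
by apply: bigmax_le => // -[i j] _ /=; rewrite ord1.
Qed.

Lemma enorm_ge0 z : 0 <= enorm z. Proof. exact: sqrtr_ge0. Qed.

Lemma enormZ c z : enorm (c *: z) = `|c| * enorm z.
Proof.
rewrite /enorm -sqrtr_sqr -sqrtrM ?sqr_ge0 // mulr_sumr.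
by congr Num.sqrt; apply: eq_bigr => i _; rewrite mxE exprMn.
Qed.

Lemma norm_le_enorm z : `|z| <= enorm z.
Proof.
apply: rV_norm_le; first exact: enorm_ge0.
move=> i; rewrite -sqrtr_sqr; apply: ler_wsqrtr.
by rewrite (bigD1 i) //= lerDl sumr_ge0 // => j _; rewrite sqr_ge0.
Qed.

Lemma enorm_le z : enorm z <= Num.sqrt (d%:R * `|z| ^+ 2).
Proof.
apply: ler_wsqrtr; rewrite -[X in X%:R * _](card_ord d) mulr_natl -sumr_const.
apply: ler_sum => i _; rewrite -real_normK ?num_real //.
by rewrite lerXn2r ?nnegrE // rV_norm_coord.
Qed.

Lemma rV_coordB (a b : 'rV[R]_d) i : (a - b) 0 i = a 0 i - b 0 i.
Proof. by rewrite !mxE. Qed.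

Lemma rV_coordZ k (a : 'rV[R]_d) i : (k *: a) 0 i = k * a 0 i.
Proof. by rewrite !mxE. Qed.

End Norms.

(** The complement of [K] is the union of the countably many rational cubes that avoid [K], and the
    preimage of a cube is a finite intersection of coordinate conditions. *)
Lemma measurable_preimage_closed n (K : set 'rV[R]_n) disp (T : measurableType disp)
    (phi : T -> 'rV[R]_n) : closed K ->
  (forall i, measurable_fun setT (fun x => phi x 0 i)) -> measurable (phi @^-1` K).
Proof.
move=> clK mphi.
pose good (qk : 'rV[rat]_n * nat) :=
  `[< forall y : 'rV[R]_n, (forall i, `|y 0 i - ratr (qk.1 0 i)| < qk.2.+1%:R^-1) -> (~` K) y >].
pose F (qk : 'rV[rat]_n * nat) : set T :=
  if good qk then \bigcap_(i : 'I_n) [set x | `|phi x 0 i - ratr (qk.1 0 i)| < qk.2.+1%:R^-1]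
  else set0.
have KF : phi @^-1` (~` K) = \bigcup_qk F qk.
  apply/seteqP; split => [x Kx|x [qk _]]; last first.
    rewrite /F; case: ifPn => // /asboolP gqk xqk; apply: gqk => i; exact: xqk.
  have /nbhs_ballP[e /= e0 eK] : nbhs (phi x) (~` K).
    by apply: open_nbhs_nbhs; split => //; exact: closed_openC.
  have [k ke] : exists k, k.+1%:R^-1 < e / 2 :> R.
    by have [k _ ke] := near_infty_natSinv_lt (PosNum (divr_gt0 e0 (ltr0Sn R 1)));
      exists k; exact: ke (leqnn k).
  have k0 : 0 < k.+1%:R^-1 :> R by rewrite invr_gt0.
  move: ke k0; set h := k.+1%:R^-1 => ke k0.
  have qP i : exists q : rat, `|phi x 0 i - ratr q| < h.
    have /rat_in_itvoo[q] : phi x 0 i - h < phi x 0 i + h by lra.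
    rewrite in_itv /= => /andP[q1 q2]; exists q; rewrite ltr_norml; apply/andP; split; lra.
  pose q : 'rV[rat]_n := \row_i sval (cid (qP i)).
  exists (q, k) => //; rewrite /F.
  have -> : good (q, k).
    apply/asboolP => y /= yq; apply: eK; rewrite -ball_normE /=.
    rewrite (@le_lt_trans _ _ (2 * h)) //; last by lra.
    apply: rV_norm_le => [|i]; first by lra.
    have := yq i; rewrite -/h /q !mxE; case: cid => r /= xr yr.
    have := ler_distD (ratr r) (phi x 0 i) (y 0 i).
    rewrite (distrC (ratr r)); lra.
  move=> i _ /=; rewrite mxE; by case: cid.
rewrite -(setCK (phi @^-1` K)) preimage_setC KF; apply: measurableC.
apply: countable_bigcupT_measurable; first exact: countableP.
move=> qk; rewrite /F; case: ifPn => // _.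
apply: fin_bigcap_measurable => // i _.
rewrite -[X in measurable X]setTI.
have mh : measurable_fun setT (fun x => `|phi x 0 i - ratr (qk.1 0 i)|).
  by apply: measurableT_comp => //; apply: measurable_funB.
have := mh measurableT `]-oo, qk.2.+1%:R^-1[%classic (measurable_itv _).
by congr measurable; apply/seteqP; split => y /=; rewrite in_itv.
Qed.

(** The densities may jump at the boundary of [Om], but as nonnegative functions vanishing off a
    closed set they are upper semicontinuous, and closed superlevel sets at positive levels
    suffice. *)
Lemma measurable_usc_comp n (p : 'rV[R]_n -> R) disp (T : measurableType disp)
    (phi : T -> 'rV[R]_n) :
  (forall y, 0 <= p y) -> (forall a, 0 < a -> closed [set y | a <= p y]) ->
  (forall i, measurable_fun setT (fun x => phi x 0 i)) ->
  measurable_fun setT (p \o phi).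
Proof.
move=> p0 clp mphi; apply: (measurability _ (RGenCInfty.measurableE R)) => _ [_ [a ->] <-].
rewrite setTI; have [a0|a0] := leP a 0.
  rewrite (_ : _ @^-1` _ = setT) //; apply/seteqP; split => // x _ /=.
  by rewrite in_itv /= andbT (le_trans a0).
have := measurable_preimage_closed (clp a a0) mphi.
by congr measurable; apply/seteqP; split => x /=; rewrite in_itv /= andbT.
Qed.

Lemma continuous_sum (T : topologicalType) (I : Type) (s : seq I) (f : I -> T -> R) :
  (forall i, continuous (f i)) -> continuous (fun x => \sum_(i <- s) f i x).
Proof.
move=> cf; elim: s => [|i s IH].
  rewrite (_ : (fun _ => _) = cst 0); first exact: cst_continuous.
  by apply/funext => x; rewrite big_nil.
rewrite (_ : (fun _ => _) = f i \+ (fun x => \sum_(j <- s) f j x)).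
  by move=> x; apply: continuousD; [exact: cf|exact: IH].
by apply/funext => x; rewrite big_cons.
Qed.

Lemma bernoulli_le (x : R) n : 0 <= x <= 1 -> 1 - n%:R * x <= (1 - x) ^+ n.
Proof.
move=> /andP[x0 x1]; elim: n => [|n IH]; first by rewrite mul0r subr0.
rewrite exprS -natr1.
have n0 : 0 <= n%:R * x by rewrite mulr_ge0.
have := ler_wpM2l (_ : 0 <= 1 - x) IH; rewrite subr_ge0 => /(_ x1); nra.
Qed.

Lemma Rintegral_increment (f : R -> R) (s t k m : R) :
  mu.-integrable `[0, 1] (EFin \o f) -> 0 <= s -> s <= t -> t <= 1 ->
  (forall x, s <= x <= t -> `|f x - k| <= m) ->
  `|\int[mu]_(x in `[0, t]) f x - \int[mu]_(x in `[0, s]) f x - (t - s) * k| <= m * (t - s).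
Proof.
move=> intf s0 st t1 fm.
have sub (a b : R) : 0 <= a -> b <= 1 -> mu.-integrable `[a, b] (EFin \o f).
  move=> a0 b1; apply: integrableS intf => //.
  by apply: subset_itv; rewrite bnd_simp.
have i0t := sub 0 t (lexx 0) t1; have ist := sub s t s0 t1.
rewrite Rintegral_itvB ?bnd_simp // Rintegral_itv_obnd_cbnd; last first.
  by apply: integrableS ist => //; exact: subset_itv_oc_cc.
have intk : mu.-integrable `[s, t] (EFin \o (fun=> k)).
  by apply: (bounded_integrable_itv (M := `|k|)) => //.
rewrite (_ : (t - s) * k = \int[mu]_(x in `[s, t]) k); last first.
  rewrite Rintegral_cst //= lebesgue_measure_itv /= lte_fin mulrC.
  by move: st; rewrite le_eqVlt => /orP[/eqP ->|->] //=; rewrite ltxx subrr.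
rewrite -RintegralB //; apply: le_normr_Rintegral_itv => //.
have := integrableB _ ist intk; move=> /(_ (measurable_itv _)).
by [].
Qed.

(** Telescoping over a uniform grid of mesh at most [del] bounds [|H T - H 0|] by [e]. The slope
    estimate is uniform in the base point, which replaces a derivative. *)
Lemma small_slope_constant (H : R -> R) (T : R) : 0 <= T ->
  (forall e, 0 < e -> exists2 del, 0 < del &
    forall s t, 0 <= s -> s < t -> t <= T -> t - s <= del -> `|H t - H s| <= e * (t - s)) ->
  H T = H 0.
Proof.
rewrite le_eqVlt => /orP[/eqP <- //|T0] slope.
apply/eqP; rewrite -subr_eq0 -normr_le0; apply/ler_addgt0Pr => e e0; rewrite add0r.
have [del del0 sl] := slope (e / T) (divr_gt0 e0 T0).
pose N := (Num.truncn (T / del)).+1.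
have N0 : 0 < N%:R :> R by rewrite ltr0n.
have Ndel : T / N%:R <= del.
  by rewrite ler_pdivrMr // mulrC -ler_pdivrMr // ltW // truncnS_gt.
set q := T / N%:R in Ndel; have q0 : 0 < q by rewrite divr_gt0.
have chain k : (k <= N)%N -> `|H (k%:R * q) - H 0| <= e / T * (k%:R * q).
  elim: k => [|k IH] kN; first by rewrite mul0r subrr normr0 mulr0.
  have kq0 : 0 <= k%:R * q by rewrite mulr_ge0 // ltW.
  have kqT : k.+1%:R * q <= T.
    by rewrite /q mulrA ler_pdivrMr // mulrC ler_pM2l // ler_nat.
  have E : k.+1%:R * q - k%:R * q = q by rewrite -natr1 mulrDl mul1r addrAC subrr add0r.
  have lt : k%:R * q < k.+1%:R * q by rewrite ltr_pM2r // ltr_nat.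
  have := sl _ _ kq0 lt kqT; rewrite E => /(_ Ndel) h1.
  have h2 := IH (ltnW kN).
  have -> : H (k.+1%:R * q) - H 0 =
    (H (k.+1%:R * q) - H (k%:R * q)) + (H (k%:R * q) - H 0) by rewrite addrA subrK.
  apply: (le_trans (ler_normD _ _)); apply: (le_trans (lerD h1 h2)).
  by rewrite -mulrDr -natr1 mulrDl mul1r addrC.
have := chain N (leqnn N); rewrite /q mulrCA divff ?gt_eqF // mulr1.
by rewrite divfK // gt_eqF.
Qed.

(** Continuation argument. Let [s] be the last time up to which [u <= 2 b]. The growth bound is
    valid until [s], and [s < t] would make [u s] strictly smaller than [2 b]; the Lipschitz bound
    then carries [u <= 2 b] beyond [s]. *)
Lemma doubling_time (u : R -> R) (L k b tau t : R) :
  0 < L -> 0 < k -> 0 < b -> tau <= t ->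
  (forall r s, tau <= r -> r <= s -> s <= t -> `|u s - u r| <= L * (s - r)) ->
  (forall s, tau <= s <= t -> (forall r, tau <= r <= s -> u r <= b + b) ->
    u s <= u tau + (s - tau) * k) ->
  u tau <= b -> t - tau <= b / k -> u t <= b + b.
Proof.
move=> L0 k0 b0 taut lip growth utau tk; rewrite leNgt; apply/negP => ut.
pose E := [set s | tau <= s <= t /\ forall r, tau <= r <= s -> u r <= b + b].
have Etau : E tau.
  split; first by rewrite lexx.
  by move=> r; rewrite -eq_le => /eqP <-; lra.
have E0 : E !=set0 by exists tau.
have Eub : has_ubound E by exists t => s [/andP[]].
pose s := sup E.
have taus : tau <= s by exact: ub_le_sup.
have st : s <= t by apply: ge_sup => // r [/andP[]].
have below r : tau <= r -> r < s -> u r <= b + b.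
  move=> tr rs; have [r' [_ Er'] rr'] := sup_gt E0 rs.
  by apply: Er'; rewrite tr ltW.
have us : u s <= b + b.
  rewrite leNgt; apply/negP => us.
  (* Going back by [e] lowers [u] by at most half of its excess over [2 b], so [u] would exceed
     [2 b] before [s]. *)
  pose e := (u s - (b + b)) / (2 * L).
  have Le : L * e = (u s - (b + b)) / 2 by rewrite /e; field; exact: lt0r_neq0.
  have e0 : 0 < e by rewrite divr_gt0 ?mulr_gt0 // subr_gt0.
  have := lip _ _ (lexx tau) taus st; rewrite ler_norml => /andP[_ l1].
  have etau : e <= s - tau by rewrite -(ler_pM2l L0); lra.
  have tr : tau <= s - e by lra.
  have rs : s - e <= s by lra.
  have := lip _ _ tr rs st; rewrite ler_norml => /andP[_].
  have := below _ tr (_ : s - e < s); rewrite ltrBlDr ltrDl => /(_ e0).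
  by rewrite opprD addNKr opprK; lra.
have belows r : tau <= r <= s -> u r <= b + b.
  move=> /andP[tr]; rewrite le_eqVlt => /orP[/eqP -> //|]; exact: below.
have st' : s < t.
  by rewrite lt_neqAle st andbT; apply/eqP => E1; move: us; rewrite E1 leNgt ut.
have us' : u s < b + b.
  have := growth s (introT andP (conj taus st)) belows.
  have : (s - tau) * k < (t - tau) * k by rewrite ltr_pM2r // ltrD2r.
  move: tk; rewrite ler_pdivlMr //; lra.
pose r := Num.min t (s + (b + b - u s) / L).
have sr : s < r by rewrite lt_min st' ltrDl divr_gt0 // subr_gt0.
suff : r <= s by rewrite leNgt sr.
apply: ub_le_sup => //; split; first by rewrite (le_trans taus (ltW sr)) ge_min lexx.
move=> q /andP[tq qr]; have [qs|sq] := leP q s; first by apply: belows; rewrite tq.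
have qt : q <= t by apply: le_trans qr _; rewrite ge_min lexx.
have := lip _ _ taus (ltW sq) qt; rewrite ler_norml => /andP[_].
have : L * (q - s) <= b + b - u s.
  rewrite mulrC -ler_pdivlMr // lerBlDl; apply: le_trans qr _.
  by rewrite ge_min lexx orbT.
lra.
Qed.

(** A cluster point of an ultrafilter is a limit. One ultrafilter can thus serve all times at once,
    with no extraction of subsequences. *)
Lemma ultra_compact_cvg (T : Type) (U : set_system T) (X : topologicalType) (A : set X)
    (f : T -> X) :
  UltraFilter U -> compact A -> (forall n, A (f n)) -> exists2 p, A p & f @ U --> p.
Proof.
move=> UU cA fA.
have FA : U (f @^-1` A).
  rewrite (_ : _ @^-1` _ = setT); first exact: filterT.
  by apply/seteqP; split => n _ //=; exact: fA.
have [p [Ap clp]] := cA (f @ U) _ FA; exists p => // V Vp.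
have [//|nV] := in_ultra_setVsetC (f @^-1` V) UU.
by have [q []] := clp (~` V) V nV Vp.
Qed.

End Space.

(** * Regularity and confinement of the velocity field *)

Record admissible (R : realType) (d : nat) (Om : set 'rV[R]_d)
    (p0 p1 : 'rV[R]_d -> R) (M c : R) : Prop := Admissible {
  adm_compact : compact Om;
  adm_convex : convex_set_rV Om;
  adm_interior : interior Om !=set0;
  adm_dim : (0 < d)%N;
  adm_ge0 : forall z, 0 <= p0 z /\ 0 <= p1 z;
  adm_le : forall z, p0 z <= M /\ p1 z <= M;
  adm_support : forall z, ~ Om z -> p0 z = 0 /\ p1 z = 0;
  adm_continuous : {within Om, continuous p0} /\ {within Om, continuous p1};
  adm_gt0 : 0 < c;
  adm_lower : forall z, Om z -> c <= p0 z /\ c <= p1 z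
}.

Section Flow.
Context {R : realType} {d : nat} (Om : set 'rV[R]_d) (p0 p1 : 'rV[R]_d -> R) (M c : R).
Context (adm : admissible Om p0 p1 M c).
Implicit Types z w : 'rV[R]_d.
Local Notation D := (diam Om).
Local Notation om := (omega Om p0 p1).
Local Notation v := (vfield Om p0 p1).

Lemma adm_closed : closed Om.
Proof. by apply: compact_closed (adm_compact adm); exact: norm_hausdorff. Qed.

Lemma diam_ub z w : Om z -> Om w -> enorm (z - w) <= D.
Proof.
move=> Oz Ow; apply: ub_le_sup; last by exists z => //; exists w.
have [N [_ bN]] := compact_bounded (adm_compact adm).
exists (Num.sqrt (d%:R * ((`|N| + 1) + (`|N| + 1)) ^+ 2)) => _ [x Ox [y Oy <-]].
have xN u : Om u -> `|u| <= `|N| + 1 by apply: bN; rewrite (le_lt_trans (ler_norm _)) // ltrDl.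
apply: (le_trans (enorm_le _)); apply: ler_wsqrtr; apply: ler_wpM2l => //.
rewrite lerXn2r ?nnegrE ?addr_ge0 //.
by rewrite (le_trans (ler_normB _ _)) // lerD // xN.
Qed.

Lemma norm_diam_ub z w : Om z -> Om w -> `|z - w| <= D.
Proof. by move=> Oz Ow; exact: le_trans (norm_le_enorm _) (diam_ub Oz Ow). Qed.

(* The norm of ['rV_d] is the sup norm: [inset rho] uses sup-norm balls, whereas [diam] and
   [omega] are Euclidean. *)
Definition inset (rho : R) z := forall w, `|w| <= rho -> Om (z + w).

Lemma inset_mem (rho : R) z : 0 <= rho -> inset rho z -> Om z.
Proof. by move=> r0 /(_ 0); rewrite normr0 addr0; apply. Qed.

Lemma inset_sub (rho rho' : R) z : rho' <= rho -> inset rho z -> inset rho' z.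
Proof. by move=> rr Iz w wr; apply: Iz; exact: le_trans rr. Qed.

Lemma interior_inset z : interior Om z -> exists2 rho, 0 < rho & inset rho z.
Proof.
move=> /nbhs_ballP[e /= e0 eO]; exists (e / 2); first by rewrite divr_gt0.
move=> w we; apply: eO; rewrite -ball_normE /= opprD addNKr normrN.
by rewrite (le_lt_trans we) // ltr_pdivrMr // ltr_pMr // ltr1n.
Qed.

Lemma inset_interior (rho : R) z : 0 < rho -> inset rho z -> interior Om z.
Proof.
move=> r0 Iz; apply/nbhs_ballP; exists rho => //= w.
rewrite -ball_normE /= distrC => /ltW wr.
by rewrite -(subrKC z w); exact: Iz.
Qed.

Lemma diam_gt0 : 0 < D.
Proof.
have [z /interior_inset[rho r0 Iz]] := adm_interior adm.
pose e : 'rV[R]_d := const_mx rho.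
have e1 : `|e| <= rho by apply: rV_norm_le => [|i]; [exact: ltW|rewrite mxE gtr0_norm].
have := norm_diam_ub (Iz _ e1) (inset_mem (ltW r0) Iz).
rewrite addrAC subrr add0r; apply: lt_le_trans; apply: (lt_le_trans r0).
apply: le_trans (rV_norm_coord e (Ordinal (adm_dim adm))).
by rewrite mxE gtr0_norm.
Qed.

(* No indicator of [Sset] is needed, since [p0] and [p1] vanish outside [Om]. *)
Definition fiber_density (t : R) z (y : 'rV[R]_d) := p0 (z - t *: y) * p1 (z + (1 - t) *: y).
Local Notation g := fiber_density.

Lemma fiber_density_ge0 t z y : 0 <= g t z y.
Proof. by rewrite mulr_ge0 // ?(adm_ge0 adm _).1 ?(adm_ge0 adm _).2. Qed.

Lemma fiber_density_neq0 t z y : g t z y != 0 -> Sset Om t z y.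
Proof.
rewrite /fiber_density mulf_eq0 negb_or => /andP[q0 q1]; split; apply: contrapT => nO.
- by rewrite (adm_support adm nO).1 eqxx in q0.
- by rewrite (adm_support adm nO).2 eqxx in q1.
Qed.

Lemma SsetE t z y : z + (1 - t) *: y - (z - t *: y) = y.
Proof. by apply/rowP => i; rewrite !mxE; ring. Qed.

Lemma Sset_le t z y : Sset Om t z y -> `|y| <= D.
Proof. by case=> O0 O1; rewrite -(SsetE t z y); exact: norm_diam_ub. Qed.

(** A positive level forces the point into [Om], so closedness relative to [Om] becomes closedness
    in the whole space. *)
Lemma superlevel_closed (p : 'rV[R]_d -> R) : {within Om, continuous p} ->
  (forall z, ~ Om z -> p z = 0) -> forall a, 0 < a -> closed [set y | a <= p y].
Proof.
move=> /continuous_closedP cp ps a a0.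
have /closed_subspaceP[V cV VE] := cp _ (@closed_ge R a).
have -> : [set y | a <= p y] = V `&` Om.
  rewrite VE; apply/seteqP; split => [y /= ay|y []//].
  by split => //; apply: contrapT => nO; move: ay; rewrite ps // leNgt a0.
exact: closedI cV adm_closed.
Qed.

Lemma lmeas_affine (t : R) z disp (T : measurableType disp) (i : 'I_d) :
  lmeas (fun (_ : T) (y : 'rV[R]_d) => (z + t *: y) 0 i).
Proof.
under [X in lmeas X]eq_fun do under eq_fun do rewrite !mxE.
apply: (lmeasD (f := fun _ _ => z 0 i)); first exact: lmeas_cst.
by apply: (lmeasM (f := fun _ _ => t)); [exact: lmeas_cst|exact: lmeas_coord].
Qed.

Lemma lgood_fiber_density t z : lgood (g t z).
Proof.
split.
  apply: (lmeasM (f := fun _ y => p0 (z - t *: y)) (g := fun _ y => p1 (z + (1 - t) *: y))).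
    apply: (lmeas_comp (F := p0) _ (Phi := fun _ y => z - t *: y)) => [disp T phi|i].
      apply: measurable_usc_comp; first by move=> y; exact: (adm_ge0 adm y).1.
      apply: superlevel_closed; first exact: (adm_continuous adm).1.
      by move=> y /(adm_support adm)[].
    under [X in lmeas X]eq_fun do under eq_fun do rewrite -scaleNr.
    exact: lmeas_affine.
  apply: (lmeas_comp (F := p1) _ (Phi := fun _ y => z + (1 - t) *: y)) => [disp T phi|i].
    apply: measurable_usc_comp; first by move=> y; exact: (adm_ge0 adm y).2.
    apply: superlevel_closed; first exact: (adm_continuous adm).2.
    by move=> y /(adm_support adm)[].
  exact: lmeas_affine.
have M0 : 0 <= M by apply: le_trans (adm_ge0 adm 0).1 (adm_le adm 0).1.
exists (M * M + D); split.
- by rewrite addr_ge0 ?mulr_ge0 // ltW // diam_gt0.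
- move=> y; rewrite ger0_norm ?fiber_density_ge0 // (@le_trans _ _ (M * M)) //; last first.
    by rewrite lerDl ltW // diam_gt0.
  by apply: ler_pM; rewrite ?(adm_ge0 adm _).1 ?(adm_ge0 adm _).2
    ?(adm_le adm _).1 ?(adm_le adm _).2.
move=> y i yi; apply/eqP; apply: contraT => /fiber_density_neq0/Sset_le yD.
have := le_trans (rV_norm_coord y i) yD; rewrite leNgt (le_lt_trans _ yi) //.
by rewrite lerDr mulr_ge0.
Qed.

Lemma vfieldE t z i : v t z 0 i = lint (fun y => y 0 i * g t z y) / lint (g t z).
Proof.
rewrite mxE; congr (_ / _); congr lint; apply/funext => y.
  rewrite -mulrA -/(g t z y); have [->|/fiber_density_neq0 Sy] := eqVneq (g t z y) 0.
    by rewrite !mulr0.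
  by rewrite indicE mem_set // mul1r.
rewrite -/(g t z y); have [->|/fiber_density_neq0 Sy] := eqVneq (g t z y) 0.
  by rewrite mulr0.
by rewrite indicE mem_set // mul1r.
Qed.

End Flow.

(** * Positive fiber mass, bound on the velocity, mean endpoint in [Om] *)

Section Velocity.
Context {R : realType} {d : nat} (Om : set 'rV[R]_d) (p0 p1 : 'rV[R]_d -> R) (M c : R).
Context (adm : admissible Om p0 p1 M c).
Implicit Types z w : 'rV[R]_d.
Local Notation D := (diam Om).
Local Notation om := (omega Om p0 p1).
Local Notation v := (vfield Om p0 p1).
Local Notation g := (fiber_density p0 p1).
(** For [|y| <= rho] both endpoints stay within [rho] of [z], so the fiber density is at least
    [c * c] on a cube. *)
Lemma lint_fiber_density_gt0 (rho t : R) z : 0 < rho -> 0 <= t <= 1 -> inset Om rho z ->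
  0 < lint (g t z).
Proof.
move=> r0 /andP[t0 t1] Iz; have c0 := adm_gt0 adm.
have gc := @lgood_cube R d rho (ltW r0).
apply: (@lt_le_trans _ _ (lint (fun y : 'rV[R]_d => c * c * cube rho y))).
  by rewrite lintZ // lint_cube ?ltW // !mulr_gt0 // exprn_gt0 // addr_gt0.
apply: le_lint; [exact: lgoodZ|exact: (lgood_fiber_density adm)|move=> y].
rewrite cubeE; case: forallP => yr; last by rewrite mulr0 (fiber_density_ge0 adm).
have yr' : `|y| <= rho by apply: rV_norm_le => //; exact: ltW.
rewrite mulr1; apply: ler_pM; rewrite ?(ltW c0) //.
- rewrite (adm_lower adm _).1 // -scaleNr; apply: Iz.
  by rewrite normrZ normrN ger0_norm // (le_trans _ yr') // ler_piMl.
- rewrite (adm_lower adm _).2 //; apply: Iz.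
  by rewrite normrZ ger0_norm ?subr_ge0 // (le_trans _ yr') // ler_piMl // gerBl.
Qed.

(* The shift by [D] makes the weight nonnegative on the fiber. *)
Definition shifted_moment (t : R) z (i : 'I_d) := lint (fun y => (D + y 0 i) * g t z y).
Local Notation W := shifted_moment.

Lemma lgood_shifted t z i : lgood (fun y => (D + y 0 i) * g t z y).
Proof.
under eq_fun do rewrite mulrDl.
apply: lgoodD; first by apply: lgoodZ; exact: (lgood_fiber_density adm).
by apply: lgood_coordM; exact: (lgood_fiber_density adm).
Qed.

Lemma shifted_momentE t z i :
  W t z i = D * lint (g t z) + lint (fun y => y 0 i * g t z y).
Proof.
rewrite /shifted_moment; under [X in lint X]eq_fun do rewrite mulrDl.
have gg := lgood_fiber_density adm t z.
by rewrite lintD ?lintZ //; [exact: lgoodZ|exact: lgood_coordM].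
Qed.

Lemma fiber_coord t z (y : 'rV[R]_d) i : g t z y != 0 -> `|y 0 i| <= D.
Proof. by move=> /(fiber_density_neq0 adm)/(Sset_le adm); exact/le_trans/rV_norm_coord. Qed.

Lemma shifted_ge0 t z (y : 'rV[R]_d) i : 0 <= (D + y 0 i) * g t z y.
Proof.
have [->|/(fiber_coord i)] := eqVneq (g t z y) 0; first by rewrite mulr0.
by rewrite ler_norml => /andP[yD _]; rewrite mulr_ge0 ?(fiber_density_ge0 adm) //; lra.
Qed.

Lemma shifted_moment_vfield t z i : 0 < lint (g t z) ->
  W t z i = (D + v t z 0 i) * lint (g t z).
Proof. by move=> B0; rewrite shifted_momentE (vfieldE adm) mulrDl divfK // gt_eqF. Qed.

Lemma vfield_coord_le t z i : `|v t z 0 i| <= D.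
Proof.
have D0 := ltW (diam_gt0 adm).
have gg := lgood_fiber_density adm t z.
(* If the mass vanishes, division by zero makes the velocity 0; the bound therefore holds at every
   [t] and [z]. *)
have := lint_ge0 (fiber_density_ge0 adm t z); rewrite le_eqVlt => /orP[/eqP B0|B0].
  by rewrite (vfieldE adm) -B0 invr0 mulr0 normr0.
have W0 : 0 <= W t z i by apply: lint_ge0 => y; exact: shifted_ge0.
have WD : W t z i <= (D + D) * lint (g t z).
  rewrite -lintZ //; apply: le_lint; [exact: lgood_shifted|exact: lgoodZ|move=> y].
  have [->|/(fiber_coord i)] := eqVneq (g t z y) 0; first by rewrite !mulr0.
  by rewrite ler_norml => /andP[_ yD]; rewrite ler_wpM2r ?(fiber_density_ge0 adm) // lerD2l.
move: W0 WD; rewrite shifted_moment_vfield // pmulr_lge0 // ler_pM2r // lerD2l ler_norml.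
by move=> ? ->; rewrite andbT; lra.
Qed.

Lemma vfield_le t z : `|v t z| <= D.
Proof. by apply: rV_norm_le => [|i]; [exact: ltW (diam_gt0 adm)|exact: vfield_coord_le]. Qed.

(* [z + (1 - t) v] is the mean of the second endpoint; the obtuse-angle inequality at the point [p]
   of [Om] nearest to it, integrated over the fiber, shows that it equals [p]. *)
Lemma conditional_mean_mem (rho t : R) z : 0 < rho -> 0 <= t <= 1 -> inset Om rho z ->
  Om (z + (1 - t) *: v t z).
Proof.
move=> r0 t01 Iz; have B0 := lint_fiber_density_gt0 r0 t01 Iz.
set m := z + _.
have [q0 Oq0] : Om !=set0 by exists z; exact: inset_mem (ltW r0) Iz.
pose dist2 (q : 'rV[R]_d) : R := \sum_i ((m 0 i - q 0 i) * (m 0 i - q 0 i)).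
have [p]: exists2 p, p \in Om & forall q, q \in Om -> dist2 p <= dist2 q.
  apply: EVT_min_rV; [by exists q0|exact: (adm_compact adm)|].
  apply: continuous_subspaceT; apply: continuous_sum => i q.
  have cq : (m 0 i - q0 0 i) @[q0 --> q] --> m 0 i - q 0 i.
    by apply: cvgB; [exact: cvg_cst|exact: coord_continuous].
  exact: (cvgM cq cq).
rewrite inE => Op pmin.
have obtuse q : Om q -> \sum_i (m 0 i - p 0 i) * (q 0 i - p 0 i) <= 0.
  move=> Oq; set s := \sum_i _.
  pose n2 := \sum_i (q 0 i - p 0 i) ^+ 2.
  (* Minimality of [p] against the point at parameter [e] of the segment from [p] to [q]. *)
  have key (e : R) : 0 <= e <= 1 -> 2 * e * s <= e ^+ 2 * n2.
    move=> e01; have := pmin ((1 - e) *: p + e *: q).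
    rewrite inE => /(_ (adm_convex adm Op Oq e01)).
    rewrite /dist2 -subr_ge0 -sumrB (_ : \sum_i _ = e ^+ 2 * n2 - 2 * e * s) ?subr_ge0 //.
    rewrite !mulr_sumr -sumrB; apply: eq_bigr => i _; rewrite !mxE; ring.
  have n20 : 0 <= n2 by apply: sumr_ge0 => i _; exact: sqr_ge0.
  rewrite leNgt; apply/negP => s0.
  (* With this [e], [e * n2 < s], whereas [key] divided by [e] gives [2 s <= e * n2]. *)
  pose e := Num.min 1 (s / (n2 + 1)).
  have e0 : 0 < e by rewrite lt_min ltr01 divr_gt0 // ltr_wpDl.
  have e1 : e <= 1 by rewrite ge_min lexx.
  have en : e * (n2 + 1) <= s by rewrite -ler_pdivlMr ?ltr_wpDl // ge_min lexx orbT.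
  have := key e; rewrite ltW // e1 => /(_ isT).
  rewrite expr2 -mulrA (mulrCA 2) -mulrA ler_pM2l //; nra.
(* An inequality affine in [y] that holds on the fiber passes to the mean: it is integrated against
   [g] and divided by the positive mass. *)
have moment (a : 'rV[R]_d) :
    (forall y, Sset Om t z y -> \sum_i a 0 i * ((z + (1 - t) *: y) 0 i - p 0 i) <= 0) ->
    \sum_i a 0 i * (m 0 i - p 0 i) <= 0.
  move=> ha; have gg := lgood_fiber_density adm t z.
  have gcM i := lgood_coordM i gg.
  pose b := \sum_i a 0 i * (z 0 i - p 0 i).
  have gs := @lgood_sum R d _ (index_enum 'I_d) (fun i y => a 0 i * (y 0 i * g t z y))
    (fun i => lgoodZ _ (gcM i)).
  have E : lint (fun y => b * g t z y + (1 - t) * \sum_i a 0 i * (y 0 i * g t z y)) <= 0.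
    rewrite -[leRHS](lint0 d); apply: le_lint.
    - apply: lgoodD; apply: lgoodZ; [exact: gg|exact: gs.1].
    - split; first exact: lmeas_cst.
      by exists 0; split => // y; rewrite normr0.
    move=> y; have [g0|/[dup] gn0 /(fiber_density_neq0 adm)/ha hy] := eqVneq (g t z y) 0.
      by rewrite g0 mulr0 big1 ?mulr0 ?addr0 // => i _; rewrite !mulr0.
    rewrite (_ : _ + _ = (\sum_i a 0 i * ((z + (1 - t) *: y) 0 i - p 0 i)) * g t z y).
      by rewrite mulr_le0_ge0 // (fiber_density_ge0 adm).
    rewrite /b !(mulr_sumr, mulr_suml) -big_split; apply: eq_bigr => i _ /=.
    rewrite !mxE; ring.
  move: E; rewrite lintD ?lintZ //; first last.
  - by apply: lgoodZ; exact: gs.1.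
  - exact: lgoodZ.
  - exact: gs.1.
  rewrite gs.2 => E; rewrite -(pmulr_lle0 _ B0); apply: le_trans E.
  rewrite le_eqVlt; apply/orP; left.
  apply/eqP; rewrite /b !(mulr_sumr, mulr_suml) -big_split; apply: eq_bigr => i _ /=.
  rewrite lintZ // /m !mxE.
  have := vfieldE adm t z i; rewrite mxE => ->.
  by field; rewrite gt_eqF.
suff -> : m = p by [].
apply/rowP => i; apply/eqP; rewrite -subr_eq0 -sqrf_eq0.
(* For [a = m - p] the fiber inequality is [obtuse] at the second endpoint, and its mean says that
   the squared distance from [m] to [p] is at most 0. *)
pose a : 'rV[R]_d := \row_j (m 0 j - p 0 j).
have aE j : a 0 j = m 0 j - p 0 j by rewrite mxE.
have a2 j : 0 <= a 0 j * (m 0 j - p 0 j) by rewrite aE -expr2 sqr_ge0.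
have /psumr_eq0P : \sum_j a 0 j * (m 0 j - p 0 j) = 0.
  apply/eqP; rewrite eq_le moment /=; last first.
    move=> y [_ O1]; apply: le_trans (obtuse _ O1); rewrite le_eqVlt; apply/orP; left.
    by apply/eqP; apply: eq_bigr => j _; rewrite aE.
  by apply: sumr_ge0 => j _.
by move=> /(_ (fun j _ => a2 j) i isT); rewrite aE -expr2 => ->.
Qed.

End Velocity.

(** * Modulus of continuity of the velocity by contraction of endpoints *)

Section Modulus.
Context {R : realType} {d : nat} (Om : set 'rV[R]_d) (p0 p1 : 'rV[R]_d -> R) (M c : R).
Context (adm : admissible Om p0 p1 M c).
Implicit Types z w : 'rV[R]_d.
Local Notation D := (diam Om).
Local Notation om := (omega Om p0 p1).
Local Notation v := (vfield Om p0 p1).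
Local Notation g := (fiber_density p0 p1).
Local Notation W := (shifted_moment Om p0 p1).
(** Makes the real supremum in [omega] a genuine one: the density ratios lie between 0 and
    [M / c]. *)
Lemma omega_set_ubound eta : has_ubound [set r : R | exists z z' : 'rV[R]_d,
  [/\ Om z, Om z', enorm (z - z') <= eta &
        r = Num.max `|p0 z / p0 z' - 1| `|p1 z / p1 z' - 1| ] ].
Proof.
have c0 := adm_gt0 adm.
have bnd (a b : R) : 0 <= a <= M -> c <= b -> `|a / b - 1| <= M / c + 1.
  move=> /andP[a0 aM] cb; have b0 : 0 < b := lt_le_trans c0 cb.
  have M0 := le_trans a0 aM.
  have abM : a / b <= M / c by apply: ler_pM; rewrite ?invr_ge0 ?(ltW b0) // lef_pV2 ?posrE.
  have ab0 : 0 <= a / b by rewrite divr_ge0 // ltW.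
  rewrite ler_norml; apply/andP; split; lra.
exists (M / c + 1) => _ [z [z' [Oz Oz' _ ->]]].
by rewrite ge_max !bnd ?(adm_lower adm Oz').1 ?(adm_lower adm Oz').2 //;
  rewrite ?(adm_ge0 adm z).1 ?(adm_ge0 adm z).2 ?(adm_le adm z).1 ?(adm_le adm z).2.
Qed.

Lemma omega_ub eta z z' : Om z -> Om z' -> enorm (z - z') <= eta ->
  `|p0 z / p0 z' - 1| <= om eta /\ `|p1 z / p1 z' - 1| <= om eta.
Proof.
move=> Oz Oz' zz'; apply/andP; rewrite -ge_max.
by apply: ub_le_sup; [exact: omega_set_ubound|exists z, z'].
Qed.

Lemma omega_ge0 eta : 0 <= eta -> 0 <= om eta.
Proof.
move=> e0; have [z /interior_subset Oz] := adm_interior adm.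
have [] := @omega_ub eta z z Oz Oz; last by move=> + _; exact: le_trans.
apply: le_trans e0; rewrite subrr /enorm big1 ?sqrtr0 // => i _.
by rewrite mxE expr0n.
Qed.

Lemma omega_mono a b : 0 <= a -> a <= b -> om a <= om b.
Proof.
move=> a0 ab; apply: ge_sup.
  have [z /interior_subset Oz] := adm_interior adm.
  exists (Num.max `|p0 z / p0 z - 1| `|p1 z / p1 z - 1|), z, z; split => //.
  apply: le_trans a0; rewrite subrr /enorm big1 ?sqrtr0 // => i _.
  by rewrite mxE expr0n.
move=> _ [z [z' [Oz Oz' zz' ->]]]; rewrite ge_max; apply/andP.
exact: omega_ub (le_trans zz' ab).
Qed.

Lemma omega_lower eta z z' : Om z -> Om z' -> enorm (z - z') <= eta ->
  (1 - om eta) * p0 z' <= p0 z /\ (1 - om eta) * p1 z' <= p1 z.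
Proof.
move=> Oz Oz' zz'; have [w0 w1] := omega_ub Oz Oz' zz'; have c0 := adm_gt0 adm.
have low (a b : R) : c <= b -> `|a / b - 1| <= om eta -> (1 - om eta) * b <= a.
  move=> cb; rewrite ler_norml => /andP[h _]; rewrite -ler_pdivlMr; first by lra.
  exact: lt_le_trans cb.
by split; apply: low => //; [exact: (adm_lower adm Oz').1|exact: (adm_lower adm Oz').2].
Qed.

(* The pair [(x0, x1)] of endpoints with difference [y] is contracted towards a common point
   [w], chosen so that the new pair averages to [z'] at time [t']. *)
Lemma fiber_density_compare (rho lam t t' : R) z z' (y : 'rV[R]_d) :
  0 < rho -> 0 < lam < 1 -> inset Om rho z' ->
  `|z - z'| + D * `|t - t'| <= lam * rho -> om (lam * D) <= 1 ->
  (1 - om (lam * D)) ^+ 2 * g t z y <= g t' z' ((1 - lam) *: y).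
Proof.
move=> r0 /andP[l0 l1] Iz' zt om1.
have [->|/(fiber_density_neq0 adm)Sy] := eqVneq (g t z y) 0.
  by rewrite mulr0 (fiber_density_ge0 adm).
have yD := Sset_le adm Sy; have [S0 S1] := Sy.
pose w := z' + ((1 - lam) / lam) *: (z' - z + (t - t') *: y).
have Ow : Om w.
  (* Since [|y| <= D], the assumption [zt] bounds [|w - z'|] by [(1 - lam) * rho], which is within
     the margin of [z']. *)
  apply: Iz'; rewrite normrZ ger0_norm ?divr_ge0 ?subr_ge0 ?(ltW l0) ?(ltW l1) //.
  rewrite mulrAC ler_pdivrMr // (@le_trans _ _ ((1 - lam) * (lam * rho))) //.
    rewrite ler_wpM2l ?subr_ge0 ?(ltW l1) //; apply: le_trans zt.
    apply: (le_trans (ler_normD _ _)); rewrite distrC lerD2l normrZ mulrC.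
    by rewrite ler_wpM2r.
  by have := mulr_gt0 l0 (mulr_gt0 l0 r0); lra.
(* Contraction towards [w] moves an endpoint by [lam] times its distance to [w], at most [lam * D];
   each density then loses at most the factor [1 - om (lam * D)]. *)
have step (x x' : 'rV[R]_d) : Om x -> x' = (1 - lam) *: x + lam *: w ->
    Om x' /\ enorm (x' - x) <= lam * D.
  move=> Ox ->; split; first by apply: (adm_convex adm) => //; rewrite (ltW l0) ltW.
  have -> : (1 - lam) *: x + lam *: w - x = lam *: (w - x).
    by apply/rowP => i; rewrite !mxE; ring.
  by rewrite enormZ gtr0_norm // ler_wpM2l ?(ltW l0) // (diam_ub adm).
have ln0 : lam != 0 by rewrite gt_eqF.
have [S0' d0] : Om (z' - t' *: ((1 - lam) *: y)) /\
    enorm (z' - t' *: ((1 - lam) *: y) - (z - t *: y)) <= lam * D.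
  apply: step => //; apply/rowP => i; rewrite !mxE; field; exact: ln0.
have [S1' d1] : Om (z' + (1 - t') *: ((1 - lam) *: y)) /\
    enorm (z' + (1 - t') *: ((1 - lam) *: y) - (z + (1 - t) *: y)) <= lam * D.
  apply: step => //; apply/rowP => i; rewrite !mxE; field; exact: ln0.
have [q0 _] := omega_lower S0' S0 d0; have [_ q1] := omega_lower S1' S1 d1.
rewrite /fiber_density expr2 mulrACA; apply: ler_pM => //.
  by rewrite mulr_ge0 ?subr_ge0 // (adm_ge0 adm _).1.
by rewrite mulr_ge0 ?subr_ge0 // (adm_ge0 adm _).2.
Qed.

Section Comparison.
Context (rho lam t t' : R) (z z' : 'rV[R]_d).
Hypothesis (r0 : 0 < rho) (l01 : 0 < lam < 1) (Iz' : inset Om rho z').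
Hypothesis (zt : `|z - z'| + D * `|t - t'| <= lam * rho) (om1 : om (lam * D) <= 1).

(** The pointwise comparison integrated after the substitution of [(1 - lam) *: y] for [y], whose
    Jacobian is [(1 - lam) ^+ d]. *)
Lemma lint_fiber_density_compare :
  (1 - lam) ^+ d * (1 - om (lam * D)) ^+ 2 * lint (g t z) <= lint (g t' z').
Proof.
have /andP[l0 l1] := l01; have k0 : 0 < 1 - lam by rewrite subr_gt0.
have gg s x := lgood_fiber_density adm s x.
have -> : lint (g t' z') = (1 - lam) ^+ d * lint (fun y => g t' z' ((1 - lam) *: y)).
  rewrite (lint_dilation k0 (gg t' z')); last exact: (fiber_density_ge0 adm).
  by rewrite mulrA -exprMn divff ?gt_eqF // expr1n mul1r.
rewrite -mulrA ler_wpM2l ?exprn_ge0 ?(ltW k0) // -lintZ //.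
apply: le_lint; [exact: lgoodZ|exact: lgood_dilation|move=> y].
exact: (fiber_density_compare y r0 l01 Iz' zt om1).
Qed.

(** The additional factor [1 - lam] comes from the weight:
    [D + (1 - lam) y_i >= (1 - lam) (D + y_i)], as [D] is positive. *)
Lemma shifted_moment_compare i :
  (1 - lam) ^+ d.+1 * (1 - om (lam * D)) ^+ 2 * W t z i <= W t' z' i.
Proof.
have /andP[l0 l1] := l01; have k0 : 0 < 1 - lam by rewrite subr_gt0.
have gg s x := lgood_shifted adm s x i.
have -> : W t' z' i = (1 - lam) ^+ d *
    lint (fun y => (D + ((1 - lam) *: y) 0 i) * g t' z' ((1 - lam) *: y)).
  rewrite (lint_dilation k0 (gg t' z')); last by move=> y; exact: (shifted_ge0 adm).
  by rewrite mulrA -exprMn divff ?gt_eqF // expr1n mul1r.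
rewrite /shifted_moment exprSr; set q := (1 - om _) ^+ 2.
rewrite (_ : _ * lint _ =
  (1 - lam) ^+ d * ((1 - lam) * q * lint (fun y => (D + y 0 i) * g t z y))); last by ring.
rewrite ler_wpM2l ?exprn_ge0 ?(ltW k0) // -lintZ //.
apply: le_lint; [exact: lgoodZ|exact: (lgood_dilation k0 (gg t' z'))|move=> y].
have [->|gn0] := eqVneq (g t z y) 0.
  by rewrite !mulr0; exact: (shifted_ge0 adm).
have := fiber_coord adm i gn0; rewrite ler_norml => /andP[yD _].
have cmp := fiber_density_compare y r0 l01 Iz' zt om1.
rewrite mxE mulrACA.
apply: ler_pM => //.
- by rewrite mulr_ge0 ?(ltW k0) //; lra.
- by rewrite mulr_ge0 ?sqr_ge0 // (fiber_density_ge0 adm).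
have := diam_gt0 adm; nra.
Qed.

End Comparison.

(* [1 - (2 d + 1) lam - 4 omega] bounds from below [(1 - lam)^(2 d + 1) (1 - omega)^4], the loss in
   the quotient of a moment (d + 1 factors [1 - lam]) by a mass (d factors). *)
Definition modulus (lam : R) : R :=
  2 * D * ((2 * d + 1)%:R * lam + 4 * om (lam * D)).

(** The moment at [(t', z')] is bounded below by that at [(t, z)], and the mass at [(t, z)] by that
    at [(t', z')], which uses the margins of both points. The quotient gives
    [D + v' >= theta (D + v)], and [D + v <= 2 D] turns [1 - theta] into an additive error. *)
Lemma vfield_compare (rho lam t t' : R) z z' i :
  0 < rho -> 0 < lam < 1 -> 0 <= t <= 1 -> 0 <= t' <= 1 ->
  inset Om rho z -> inset Om rho z' ->
  `|z - z'| + D * `|t - t'| <= lam * rho -> om (lam * D) <= 1 ->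
  v t z 0 i - v t' z' 0 i <= modulus lam.
Proof.
move=> r0 l01 t01 t01' Iz Iz' zt om1; have /andP[l0 l1] := l01.
have B0 := lint_fiber_density_gt0 adm r0 t01 Iz.
have B0' := lint_fiber_density_gt0 adm r0 t01' Iz'.
have := shifted_moment_compare r0 l01 Iz' zt om1 i.
rewrite distrC (distrC t) in zt.
have := lint_fiber_density_compare r0 l01 Iz zt om1.
rewrite !(shifted_moment_vfield adm) //.
set B := lint (g t z); set B' := lint (g t' z').
have := vfield_coord_le adm t z i; rewrite ler_norml => /andP[vD1 vD2].
have := vfield_coord_le adm t' z' i; rewrite ler_norml => /andP[vD1' vD2'].
have D0 := diam_gt0 adm.
have om0 : 0 <= om (lam * D) by apply: omega_ge0; rewrite mulr_ge0 ?ltW.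
set q := (1 - om (lam * D)) ^+ 2; set k := 1 - lam.
have q0 : 0 <= q by exact: sqr_ge0.
have k0 : 0 < k by rewrite subr_gt0.
move=> hB hW.
have theta : k ^+ (2 * d + 1) * q ^+ 2 * (D + v t z 0 i) <= D + v t' z' 0 i.
  rewrite -(ler_pM2r B0'); apply: le_trans hW.
  rewrite (_ : _ * B' = k ^+ d.+1 * q * (D + v t z 0 i) * (k ^+ d * q * B')).
    rewrite [leRHS]mulrA ler_wpM2l // !mulr_ge0 ?exprn_ge0 ?(ltW k0) //; lra.
  have -> : k ^+ (2 * d + 1) = k ^+ d.+1 * k ^+ d.
    by rewrite -exprD addSn addn1 addnn mul2n.
  rewrite expr2; move: (k ^+ d.+1) (k ^+ d) => a b; ring.
(* Bernoulli for each power; two factors in [[0, 1]] that are at least [1 - a] and [1 - b] have a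
   product of at least [1 - a - b]. *)
have kq : 1 - (2 * d + 1)%:R * lam - 4 * om (lam * D) <= k ^+ (2 * d + 1) * q ^+ 2.
  have h1 : 1 - (2 * d + 1)%:R * lam <= k ^+ (2 * d + 1).
    by apply: bernoulli_le; rewrite !ltW.
  have h2 : 1 - 4 * om (lam * D) <= q ^+ 2.
    by rewrite /q -exprM; apply: (@bernoulli_le _ _ 4); rewrite om0 om1.
  have h3 : 0 <= q ^+ 2 <= 1.
    by rewrite sqr_ge0 /q -exprM exprn_ile1 // ?subr_ge0 // gerBl.
  have h4 : 0 <= k ^+ (2 * d + 1) <= 1.
    by rewrite exprn_ge0 ?(ltW k0) // exprn_ile1 ?(ltW k0) // gerBl ltW.
  nra.
rewrite /modulus; move: theta kq.
set th := k ^+ _ * _; set s := (2 * d + 1)%:R * lam; set u := 4 * om _ => theta kq.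
have th1 : (1 - th) <= s + u by lra.
have su0 : 0 <= s + u by rewrite addr_ge0 // mulr_ge0 // ltW.
have : (1 - th) * (D + v t z 0 i) <= (s + u) * (D + v t z 0 i) by apply: ler_wpM2r => //; lra.
have : (s + u) * (D + v t z 0 i) <= (s + u) * (2 * D) by apply: ler_wpM2l => //; lra.
lra.
Qed.

Lemma modulus_ge0 lam : 0 <= lam -> 0 <= modulus lam.
Proof.
move=> l0; have D0 := ltW (diam_gt0 adm).
by rewrite !mulr_ge0 // addr_ge0 // mulr_ge0 // omega_ge0 // mulr_ge0.
Qed.

Lemma vfield_modulus (rho lam t t' : R) z z' :
  0 < rho -> 0 <= lam -> 0 <= t <= 1 -> 0 <= t' <= 1 ->
  inset Om rho z -> inset Om rho z' ->
  `|z - z'| + D * `|t - t'| <= lam * rho ->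
  `|v t z - v t' z'| <= modulus lam.
Proof.
move=> r0 l0 t01 t01' Iz Iz' zt; have D0 := diam_gt0 adm.
have m0 := modulus_ge0 l0.
(* At [lam = 0] the points and the times coincide, because [D > 0]. *)
have [lz|ln0] := eqVneq lam 0.
  have /andP[/eqP z0 /eqP t0] : (`|z - z'| == 0) && (D * `|t - t'| == 0).
    by rewrite -paddr_eq0 ?mulr_ge0 ?(ltW D0) // eq_le addr_ge0 ?mulr_ge0 ?(ltW D0) // andbT
      (le_trans zt) // lz mul0r.
  have /eqP : z - z' = 0 by apply/eqP; rewrite -normr_eq0 z0.
  have : t - t' = 0.
    by apply/eqP; rewrite -normr_eq0; move/eqP: t0; rewrite mulf_eq0 gt_eqF.
  by rewrite subr_eq0 => /eqP /[!subr_eq0] /eqP -> /eqP ->; rewrite subrr normr0.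
have {ln0}l0' : 0 < lam by rewrite lt_def ln0.
apply: rV_norm_le => // i; rewrite !mxE.
(* Outside the range of [vfield_compare] the modulus is at least [2 * D], the trivial bound on the
   difference of two velocity coordinates. *)
have big : 1 <= lam \/ 1 < om (lam * D) -> 2 * D <= modulus lam.
  move=> h; rewrite /modulus ler_peMr ?mulr_ge0 ?(ltW D0) //.
  have om0 : 0 <= om (lam * D) by apply: omega_ge0; rewrite mulr_ge0 ?(ltW D0).
  have : lam <= (2 * d + 1)%:R * lam by rewrite ler_peMl // ler1n addn1.
  by case: h => h; lra.
have vD s x := vfield_coord_le adm s x i.
have [big1|l1] := leP 1 lam.
  have := big (or_introl big1); move: (vD t z) (vD t' z').
  rewrite !mxE !ler_norml; lra.
have [om1|big1] := leP (om (lam * D)) 1; last first.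
  have := big (or_intror big1); move: (vD t z) (vD t' z').
  rewrite !mxE !ler_norml; lra.
have h1 := vfield_compare i r0 (introT andP (conj l0' l1)) t01 t01' Iz Iz' zt om1.
rewrite distrC (distrC t) in zt.
have h2 := vfield_compare i r0 (introT andP (conj l0' l1)) t01' t01 Iz' Iz zt om1.
move: h1 h2; rewrite !mxE ler_norml; lra.
Qed.

End Modulus.

(** * The Osgood condition and uniqueness *)

Section Osgood.
Context {R : realType} {d : nat} (Om : set 'rV[R]_d) (p0 p1 : 'rV[R]_d -> R) (M c : R).
Context (adm : admissible Om p0 p1 M c).
Local Notation mu := (@lebesgue_measure R).
Local Notation D := (diam Om).
Local Notation om := (omega Om p0 p1).
Local Notation v := (vfield Om p0 p1).
Hypothesis osgood : (fun eps : R => (\int[@lebesgue_measure R]_(u in `[eps, diam Om])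
                      ((u + omega Om p0 p1 u)^-1)%:E)%E) @ 0^'+ --> +oo%E.
(** Monotone functions are measurable; freezing the argument below [a] extends the monotonicity to
    the whole line. *)
Lemma measurable_inv_omega (a b : R) : 0 < a ->
  measurable_fun `[a, b] (fun u => (u + om u)^-1).
Proof.
move=> a0; pose h (u : R) := - (Num.max a u + om (Num.max a u))^-1.
have mh : measurable_fun setT h.
  apply: nondecreasing_measurable => // x y xy; rewrite lerN2.
  have m0 z : 0 < Num.max a z by rewrite lt_max a0.
  have p z : 0 < Num.max a z + om (Num.max a z).
    by rewrite ltr_wpDr // (omega_ge0 adm) // ltW.
  have mxy : Num.max a x <= Num.max a y by rewrite ge_max !le_max lexx xy !orbT.
  by rewrite lef_pV2 ?posrE // lerD // (omega_mono adm) // ltW.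
apply: (eq_measurable_fun (\- h)); last by apply: measurable_funTS; exact: measurable_funN.
by move=> u; rewrite inE /= in_itv /= => /andP[au _]; rewrite /h opprK max_r.
Qed.

Definition dyadic (j : nat) : R := D / 2 ^+ j.

Lemma dyadic_gt0 j : 0 < dyadic j.
Proof. by rewrite divr_gt0 ?exprn_gt0 // (diam_gt0 adm). Qed.

Lemma dyadicS j : dyadic j = dyadic j.+1 + dyadic j.+1.
Proof. rewrite /dyadic exprS; field; by rewrite expf_neq0. Qed.

Lemma dyadic_small (e : R) : 0 < e -> exists N, dyadic N < e.
Proof.
move=> e0; exists (Num.truncn (D / e)).+1; rewrite ltr_pdivrMr ?exprn_gt0 // mulrC -ltr_pdivrMr //.
apply: (lt_trans (truncnS_gt _)).
by rewrite -natrX ltr_nat ltn_expl.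
Qed.

Definition osgood_term (j : nat) : R := dyadic j / (dyadic j + om (dyadic j)).

Lemma osgood_den_gt0 j : 0 < dyadic j + om (dyadic j).
Proof. by rewrite ltr_wpDr ?dyadic_gt0 // (omega_ge0 adm) // ltW // dyadic_gt0. Qed.

Lemma osgood_term_bound j : 0 <= osgood_term j <= 1.
Proof.
have h := osgood_den_gt0 j; rewrite divr_ge0 ?(ltW h) ?(ltW (dyadic_gt0 j)) //=.
by rewrite ler_pdivrMr // mul1r lerDl (omega_ge0 adm) // ltW // dyadic_gt0.
Qed.

(** The interval from [dyadic N.+1] to [dyadic N] has length [dyadic N.+1], and the integrand is
    largest at its left end; the product of the two is [osgood_term N.+1]. *)
Lemma osgood_integral_le N :
  (\int[mu]_(u in `[dyadic N, D]) ((u + om u)^-1)%:E <= (\sum_(j < N) osgood_term j.+1)%:E)%E.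
Proof.
elim: N => [|N IH].
  by rewrite big_ord0 /dyadic expr0 divr1 set_itv1 integral_set1.
have d1 := dyadic_gt0 N.+1; have d0 := dyadic_gt0 N; have dS := dyadicS N.
have dD : dyadic N <= D.
  by rewrite ler_pdivrMr ?exprn_gt0 // ler_peMr ?exprn_ege1 ?ler1n // ltW // (diam_gt0 adm).
have pos (u : R) : dyadic N.+1 <= u -> 0 <= (u + om u)^-1.
  move=> du; have u0 := le_trans (ltW d1) du.
  by rewrite invr_ge0 addr_ge0 // (omega_ge0 adm).
have mF b : measurable_fun `[dyadic N.+1, b] (fun u => ((u + om u)^-1)%:E).
  by apply/measurable_EFinP; exact: measurable_inv_omega.
rewrite (@itv_bndbnd_setU _ _ _ (BLeft (dyadic N))) ?bnd_simp //; last by lra.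
rewrite ge0_integral_setU //; first last.
- apply/disj_setPS => y [/=]; rewrite !in_itv /= => /andP[_ yN] /andP[].
  by rewrite leNgt yN.
- move=> x /= [|]; rewrite in_itv /= lee_fin => /andP[xN _]; apply: pos => //.
  by apply: le_trans xN; lra.
- by rewrite -itv_bndbnd_setU ?bnd_simp //; [exact: mF|lra].
rewrite big_ord_recr /= EFinD addeC; apply: leeD; last exact: IH.
apply: (@le_trans _ _ (\int[mu]_(u in `[dyadic N.+1, dyadic N[)
    (cst ((dyadic N.+1 + om (dyadic N.+1))^-1)%:E u))%E).
  apply: ge0_le_integral => //.
  - by move=> x /=; rewrite in_itv /= lee_fin => /andP[xN _]; exact: pos.
  - by apply: measurable_funS (mF (dyadic N)) => //; exact: subset_itv_co_cc.
  - move=> x /=; rewrite in_itv /= lee_fin => /andP[xN _].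
    rewrite lef_pV2 ?posrE; last exact: osgood_den_gt0.
      by rewrite lerD // (omega_mono adm) // ltW.
    by rewrite ltr_wpDr ?(omega_ge0 adm) // ?(lt_le_trans d1) // (le_trans (ltW d1)).
rewrite integral_cst //= lebesgue_measure_itv /= lte_fin ifT; last by lra.
by rewrite -EFinB -EFinM lee_fin /osgood_term mulrC {1}dS addrK.
Qed.

Lemma osgood_series A : exists N, A <= \sum_(j < N) osgood_term j.+1.
Proof.
have : \forall e \near 0^'+, (A%:E < \int[mu]_(u in `[e, D]) ((u + om u)^-1)%:E)%E.
  by move/cvgey_gt : osgood; apply; exact: num_real.
move=> /nbhs_ballP[e /= e0 eA].
have [N Ne] := dyadic_small e0; exists N; rewrite -lee_fin.
apply: (le_trans (ltW _) (osgood_integral_le N)); apply: eA; last exact: dyadic_gt0.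
by rewrite -ball_normE /= sub0r normrN gtr0_norm // dyadic_gt0.
Qed.

(** If [om] stayed above [e], each term would be at most [dyadic j / e] and the partial sums at most
    [D / e], against divergence. *)
Lemma omega_small (e : R) : 0 < e -> exists2 eta, 0 < eta & om eta <= e.
Proof.
move=> e0; apply: contrapT => H.
have big j : e < om (dyadic j).
  by rewrite ltNge; apply/negP => h; apply: H; exists (dyadic j) => //; exact: dyadic_gt0.
have [N] := osgood_series (D / e + 1).
have dsum : \sum_(j < N) dyadic j.+1 = D - dyadic N.
  elim: N => [|N IH]; first by rewrite big_ord0 /dyadic expr0 divr1 subrr.
  by rewrite big_ord_recr /= IH (dyadicS N); lra.
have : \sum_(j < N) osgood_term j.+1 <= \sum_(j < N) dyadic j.+1 / e.
  apply: ler_sum => j _; rewrite /osgood_term ler_wpM2l ?(ltW (dyadic_gt0 _)) //.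
  rewrite lef_pV2 ?posrE ?osgood_den_gt0 // (le_trans (ltW (big j.+1))) //.
  by rewrite lerDr ltW // dyadic_gt0.
rewrite -mulr_suml dsum => h1 h2.
have : (D - dyadic N) / e <= D / e.
  by rewrite ler_wpM2r ?invr_ge0 ?(ltW e0) // gerBl ltW // dyadic_gt0.
lra.
Qed.

Local Notation K := (modulus Om p0 p1).

Lemma modulus_small (e : R) : 0 < e -> exists2 lam, 0 < lam & K lam <= e.
Proof.
move=> e0; have D0 := diam_gt0 adm.
have e1 : 0 < e / (16 * D) by rewrite divr_gt0 // mulr_gt0.
have [eta eta0 oeta] := omega_small e1.
have n0 : 0 < (2 * d + 1)%:R :> R by rewrite ltr0n addn1.
(* The first entry makes [om (lam * D)] at most [e / (16 * D)], the second the linear part at most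
   [e / (4 * D)]; each then contributes [e / 2] to the modulus. *)
pose lam := Num.min (eta / D) (e / (4 * D * (2 * d + 1)%:R)).
have l0 : 0 < lam by rewrite lt_min !divr_gt0 // !mulr_gt0.
exists lam => //.
have l1 : om (lam * D) <= e / (16 * D).
  apply: le_trans oeta; apply: (omega_mono adm); first by rewrite mulr_ge0 // ltW.
  by rewrite -ler_pdivlMr // ge_min lexx.
have l2 : (2 * d + 1)%:R * lam <= e / (4 * D).
  rewrite mulrC -ler_pdivlMr // ge_min; apply/orP; right.
  by rewrite invfM mulrA.
rewrite /modulus (_ : e = 2 * D * (e / (4 * D) + 4 * (e / (16 * D)))).
  by rewrite ler_wpM2l ?mulr_ge0 ?(ltW D0) // lerD // ler_wpM2l.
field; exact: lt0r_neq0.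
Qed.

Lemma modulus_gt0 lam : 0 < lam -> 0 < K lam.
Proof.
move=> l0; have D0 := diam_gt0 adm.
rewrite !mulr_gt0 // ltr_pwDl //; first by rewrite mulr_gt0 // ltr0n addn1.
by rewrite mulr_ge0 // (omega_ge0 adm) // mulr_ge0 // ltW.
Qed.

(** [Delta j] bounds from below the time needed to climb from level [lam j.+1 * rho] to level
    [lam j * rho]. Starting below all levels, [u] must cross infinitely many of them to become
    positive, and the times [Delta j] have a divergent sum. *)
Lemma osgood_vanish (u : R -> R) (L rho T : R) :
  0 < L -> 0 < rho -> u 0 <= 0 ->
  (forall r s, 0 <= r -> r <= s -> s <= T -> `|u s - u r| <= L * (s - r)) ->
  (forall r s lam, 0 <= r -> r <= s -> s <= T -> 0 <= lam ->
    (forall q, r <= q <= s -> u q <= lam * rho) -> u s <= u r + (s - r) * K lam) ->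
  forall t, 0 <= t <= T -> u t <= 0.
Proof.
move=> L0 r0 u0 lip growth t0 /andP[t00 t0T]; have D0 := diam_gt0 adm.
pose lam (j : nat) : R := 1 / 2 ^+ j.
have lam0 j : 0 < lam j by rewrite divr_gt0 // exprn_gt0.
have lamS j : lam j = lam j.+1 + lam j.+1.
  by rewrite /lam exprS; field; rewrite expf_neq0.
pose Delta (j : nat) := lam j.+1 * rho / K (lam j).
have Delta0 j : 0 < Delta j by apply: divr_gt0; [rewrite mulr_gt0|exact: modulus_gt0].
(* Induction on the number [i] of levels: until [S], the time allotted to the deeper levels, [u] is
   below level [J.+1]; the remaining time is at most [Delta J], too short to pass level [J]. *)
have climb i J t : 0 <= t <= T -> t <= \sum_(k < i) Delta (J + k)%N -> u t <= lam J * rho.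
  elim: i J t => [|i IH] J t /andP[t1 tT].
    rewrite big_ord0 => t2; have -> : t = 0 by apply/eqP; rewrite eq_le t2.
    by apply: (le_trans u0); rewrite mulr_ge0 // ltW.
  rewrite big_ord_recl addn0 /=.
  under eq_bigr do rewrite /bump /= addnA addn1.
  set S := \sum_(k < i) _ => tS.
  have S0 : 0 <= S by apply: sumr_ge0 => k _; exact: ltW.
  have half : lam J * rho = lam J.+1 * rho + lam J.+1 * rho by rewrite (lamS J) mulrDl.
  have lr : 0 < lam J.+1 * rho by rewrite mulr_gt0.
  have [tS'|St] := leP t S.
    by have := IH J.+1 t; rewrite t1 tT => /(_ isT tS'); lra.
  have uS : u S <= lam J.+1 * rho by apply: (IH J.+1) => //; rewrite S0 (le_trans (ltW St)).
  rewrite half; apply: (@doubling_time R u L (K (lam J)) _ S t) => //.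
  - exact: modulus_gt0.
  - exact: ltW.
  - move=> r s Sr rs st; apply: lip => //; first exact: le_trans Sr.
    exact: le_trans tT.
  - move=> s /andP[Ss st] us; apply: growth => //.
    + exact: le_trans tT.
    + exact: ltW.
    + by move=> q qs; rewrite half; exact: us.
  - by move: tS; rewrite /Delta; lra.
(* The constant comes from [D * K (lam j) <= 2 * D * (2 d + 1 + 4 D) * (dyadic j + om (dyadic j))]
   and [lam j.+1 = lam j / 2]. *)
pose kap := rho / (4 * D * ((2 * d + 1)%:R + 4 * D)).
have n0 : 0 < (2 * d + 1)%:R :> R by rewrite ltr0n addn1.
have den0 : 0 < (2 * d + 1)%:R + 4 * D by rewrite addr_gt0 // mulr_gt0.
have kap0 : 0 < kap by rewrite divr_gt0 // !mulr_gt0.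
have DeltaE j : kap * osgood_term j <= Delta j.
  have sE : dyadic j = lam j * D by rewrite /dyadic /lam mulrC mul1r.
  have K0 := modulus_gt0 (lam0 j).
  rewrite /Delta ler_pdivlMr // /osgood_term.
  have w0 := osgood_den_gt0 j.
  have wj : 0 <= om (dyadic j) by apply: (omega_ge0 adm); exact: ltW (dyadic_gt0 j).
  have KE : D * K (lam j) <= 2 * D * (((2 * d + 1)%:R + 4 * D) * (dyadic j + om (dyadic j))).
    rewrite /modulus mulrCA ler_wpM2l ?mulr_ge0 ?(ltW D0) // -sE.
    rewrite mulrDr mulrCA (mulrC D (lam j)) -sE.
    have h1 := mulr_ge0 (ltW n0) wj; have h2 := mulr_ge0 (ltW D0) (ltW (dyadic_gt0 j)).
    move: h1 h2; set n := (2 * d + 1)%:R; set w := om _; lra.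
  have : kap * (dyadic j / (dyadic j + om (dyadic j))) * (D * K (lam j)) <=
      kap * (dyadic j / (dyadic j + om (dyadic j))) *
      (2 * D * (((2 * d + 1)%:R + 4 * D) * (dyadic j + om (dyadic j)))).
    apply: ler_wpM2l => //; apply: mulr_ge0; first exact: ltW.
    by apply: divr_ge0; [exact: ltW (dyadic_gt0 j)|exact: ltW].
  rewrite [leRHS](_ : _ = D * (lam j.+1 * rho)).
    by rewrite mulrCA ler_pM2l.
  rewrite /kap {1}sE (lamS j); move: den0 w0.
  set A := _ + 4 * D; set B := _ + om _ => A0 B0.
  field; rewrite !lt0r_neq0 //.
(* Each term is at most 1, so shifting the series by [J] loses at most [J] and the tails still
   diverge. *)
have tails J N : \sum_(k < N) osgood_term k.+1 <= J%:R + \sum_(k < N) osgood_term (J + k).+1.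
  elim: J => [|J IH]; first by rewrite add0r.
  apply: (le_trans IH); rewrite -natr1 -addrA lerD2l.
  have /andP[w1 w2] := osgood_term_bound (J + 0).+1.
  have /andP[w3 _] := osgood_term_bound (J + N).+1.
  have : osgood_term (J + 0).+1 + \sum_(k < N) osgood_term (J.+1 + k).+1 =
      \sum_(k < N) osgood_term (J + k).+1 + osgood_term (J + N).+1.
    transitivity (\sum_(k < N.+1) osgood_term (J + k).+1); last by rewrite big_ord_recr.
    rewrite big_ord_recl; congr (_ + _); apply: eq_bigr => k _.
    by rewrite /bump /= addSnnS.
  lra.
rewrite leNgt; apply/negP => ut.
(* A positive value [u t0] exceeds some level; climbing to that level within time [T] is then
   excluded. *)
have [J hJ0] : exists J, dyadic J < u t0 / rho * D.
  by apply: dyadic_small; rewrite mulr_gt0 ?divr_gt0.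
have hJ : lam J.+1 * rho < u t0.
  have sE : dyadic J = lam J * D by rewrite /dyadic /lam mulrC mul1r.
  move: hJ0; rewrite sE ltr_pM2r // ltr_pdivlMr //.
  apply: le_lt_trans; rewrite ler_wpM2r ?(ltW r0) // (lamS J) lerDl ltW //.
have [N hN] := osgood_series (T / kap + J%:R).
have : u t0 <= lam J.+1 * rho.
  apply: (climb N); first by rewrite t00.
  apply: (le_trans t0T); apply: (@le_trans _ _ (\sum_(k < N) kap * osgood_term (J + k).+1)).
    rewrite -mulr_sumr mulrC -ler_pdivrMr //; have := tails J N; lra.
  by apply: ler_sum => k _; rewrite addSn; exact: DeltaE.
by rewrite leNgt hJ.
Qed.

End Osgood.

(** * Uniqueness of solutions *)

Section Solutions.
Context {R : realType} {d : nat} (Om : set 'rV[R]_d) (p0 p1 : 'rV[R]_d -> R) (M c : R).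
Context (adm : admissible Om p0 p1 M c).
Local Notation mu := (@lebesgue_measure R).
Local Notation D := (diam Om).
Local Notation om := (omega Om p0 p1).
Local Notation v := (vfield Om p0 p1).
Hypothesis osgood : (fun eps : R => (\int[@lebesgue_measure R]_(u in `[eps, diam Om])
                      ((u + omega Om p0 p1 u)^-1)%:E)%E) @ 0^'+ --> +oo%E.
Local Notation K := (modulus Om p0 p1).
Section GivenSolution.
Context (x : 'rV[R]_d) (z : R -> 'rV[R]_d).
Hypothesis (zsol : cara_solution Om p0 p1 x z).

Lemma cara_solution_increment (s t m : R) (k : 'rV[R]_d) : 0 <= s -> s <= t -> t <= 1 ->
  (forall q, s <= q <= t -> `|v q (z q) - k| <= m) ->
  `|z t - z s - (t - s) *: k| <= m * (t - s).
Proof.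
have [_ _ int_v zE] := zsol.
move=> s0 st t1 vk; apply: rV_norm_le => [|i].
  by rewrite mulr_ge0 ?subr_ge0 // (le_trans _ (vk s _)) // lexx.
have s1 := le_trans st t1; have t0 := le_trans s0 st.
have := Rintegral_increment (k := k 0 i) (m := m) (int_v i) s0 st t1.
rewrite (zE t) ?t0 // (zE s) ?s0 // !mxE opprD addrACA subrr add0r.
apply=> q sqt; apply: le_trans (vk q sqt).
by have := rV_norm_coord (v q (z q) - k) i; rewrite !mxE.
Qed.

Lemma cara_solution_lipschitz (s t : R) : 0 <= s -> s <= t -> t <= 1 ->
  `|z t - z s| <= D * (t - s).
Proof.
move=> s0 st t1; have := @cara_solution_increment s t D 0 s0 st t1.
rewrite scaler0 subr0; apply=> q _.
by rewrite subr0; exact: (vfield_le adm).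
Qed.

Lemma cara_solution0 : z 0 = x.
Proof.
have [_ _ _ zE] := zsol; rewrite zE ?lexx ?ler01 //.
by apply/rowP => i; rewrite !mxE set_itv1 Rintegral_set1 addr0.
Qed.

End GivenSolution.

(** Only [z] has a known margin, that of the Euler limit. Up to a time [T < 1], [osgood_vanish]
    applies with [rh], half the margin of [z] at [T]: as long as the distance is at most [rh], [z']
    has margin [rh] too. Time 1 follows from the Lipschitz bounds. *)
Lemma cara_solution_unique (x : 'rV[R]_d) (rho : R) (z z' : R -> 'rV[R]_d) : 0 < rho ->
  (forall t, 0 <= t <= 1 -> inset Om ((1 - t) * rho) (z t)) ->
  cara_solution Om p0 p1 x z -> cara_solution Om p0 p1 x z' ->
  forall t, 0 <= t <= 1 -> z' t = z t.
Proof.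
move=> r0 Iz zs zs'; have D0 := diam_gt0 adm.
pose u t := `|z' t - z t|.
have lipu r s : 0 <= r -> r <= s -> s <= 1 -> `|u s - u r| <= (2 * D) * (s - r).
  move=> r0' rs s1; apply: (le_trans (ler_dist_dist _ _)).
  have h1 := cara_solution_lipschitz zs r0' rs s1.
  have h2 := cara_solution_lipschitz zs' r0' rs s1.
  rewrite (_ : _ - _ = (z' s - z' r) - (z s - z r)); last first.
    by rewrite !opprB addrACA [RHS]addrACA; congr (_ + _); rewrite addrC.
  apply: (le_trans (ler_normB _ _)); lra.
have before1 T : 0 <= T -> T < 1 -> u T <= 0.
  move=> T0 T1; pose rh := (1 - T) * rho / 2.
  have rT : 0 < (1 - T) * rho by rewrite mulr_gt0 // subr_gt0.
  have rh0 : 0 < rh by rewrite divr_gt0.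
  suff : forall t, 0 <= t <= T -> u t <= 0 by apply; rewrite T0 lexx.
  apply: (osgood_vanish adm osgood (L := 2 * D) (rho := rh)) => //.
  - by rewrite mulr_gt0.
  - by rewrite /u (cara_solution0 zs) (cara_solution0 zs') subrr normr0.
  - by move=> r s r0' rs sT; apply: lipu => //; lra.
  - move=> r s lam r0' rs sT l0 ul.
    have s1 : s <= 1 by lra.
    (* For [lam >= 1] the bound is trivial; otherwise [z'] inherits half of the margin of [z]. *)
    have [lam1|lam1] := leP 1 lam.
      have := lipu r s r0' rs s1; rewrite ler_norml => /andP[_].
      have : 2 * D * (s - r) <= (s - r) * K lam.
        rewrite mulrC ler_wpM2l ?subr_ge0 // /modulus ler_peMr ?mulr_ge0 ?(ltW D0) //.
        have := omega_ge0 adm (mulr_ge0 l0 (ltW D0)).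
        have : lam <= (2 * d + 1)%:R * lam by rewrite ler_peMl // ler1n addn1.
        by rewrite (lock (om _)); lra.
      lra.
    suff : `|(z' s - z s) - (z' r - z r)| <= (s - r) * K lam.
      move=> h; rewrite /u -lerBlDl; apply: le_trans h; exact: lerB_dist.
    apply: rV_norm_le => [|i].
      by rewrite mulr_ge0 ?subr_ge0 // (modulus_ge0 adm).
    have [_ _ int_v zE] := zs; have [_ _ int_v' zE'] := zs'.
    pose f q := v q (z' q) 0 i - v q (z q) 0 i.
    have intf : mu.-integrable `[0, 1] (EFin \o f).
      have := integrableB _ (int_v' i) (int_v i); move=> /(_ (measurable_itv _)).
      by [].
    have sub q : 0 <= q -> q <= 1 -> `[0, q] `<=` (`[0, 1]%classic : set R).
      by move=> q0 q1; apply: subset_itv; rewrite bnd_simp.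
    have fE q : 0 <= q <= 1 -> \int[mu]_(y in `[0, q]) f y = (z' q - z q) 0 i.
      move=> /andP[q0 q1]; rewrite RintegralB //.
      + rewrite (zE q) ?q0 // (zE' q) ?q0 // !mxE; ring.
      + by apply: integrableS (int_v' i) => //; exact: sub.
      + by apply: integrableS (int_v i) => //; exact: sub.
    have := @Rintegral_increment R f r s 0 (K lam) intf r0' rs s1.
    have s0 := le_trans r0' rs; have r1 := le_trans rs s1.
    rewrite (fE s) ?s0 // (fE r) ?r0' // mulr0 subr0 !mxE [K lam * _]mulrC; apply.
    move=> q /andP[rq qs]; rewrite subr0 /f.
    have q01 : 0 <= q <= 1 by apply/andP; split; lra.
    have Iq : inset Om ((1 - T) * rho) (z q).
      by apply: inset_sub (Iz q q01); rewrite ler_pM2r //; lra.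
    have uq := ul q (introT andP (conj rq qs)).
    have Iq1 : inset Om rh (z q) by apply: inset_sub Iq; rewrite /rh; lra.
    have Iq2 : inset Om rh (z' q).
      move=> w wr; rewrite (_ : z' q + w = z q + ((z' q - z q) + w)); last first.
        by rewrite addrA subrKC.
      apply: Iq; apply: (le_trans (ler_normD _ _)).
      have : lam * rh <= rh by rewrite ger_pMl // ltW.
      rewrite -/(u q) /rh in uq wr *; lra.
    have := vfield_modulus adm rh0 l0 q01 q01 Iq2 Iq1 (lam := lam).
    rewrite subrr normr0 mulr0 addr0 => /(_ uq).
    by apply: le_trans; have := rV_norm_coord (v q (z' q) - v q (z q)) i; rewrite !mxE.
have all_le t : 0 <= t <= 1 -> u t <= 0.
  move=> /andP[t0]; rewrite le_eqVlt => /orP[/eqP ->|]; last exact: before1.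
  apply/ler_addgt0Pr => e e0; rewrite add0r.
  pose h := Num.min 1 (e / (2 * D)).
  have h0 : 0 < h by rewrite lt_min ltr01 divr_gt0 ?mulr_gt0.
  have h1 : h <= 1 by rewrite ge_min lexx.
  have he : 2 * D * h <= e by rewrite mulrC -ler_pdivlMr ?mulr_gt0 // ge_min lexx orbT.
  have H0 : 0 <= 1 - h by rewrite subr_ge0.
  have H1 : 1 - h <= 1 by rewrite gerBl ltW.
  have := lipu (1 - h) 1 H0 H1 (lexx 1); rewrite ler_norml => /andP[_].
  rewrite subKr; have := before1 (1 - h) H0; rewrite gtrBl => /(_ h0); lra.
move=> t t01; apply/eqP; rewrite -subr_eq0 -normr_le0; exact: all_le.
Qed.

End Solutions.

(** * Existence *)

Section Existence.
Context {R : realType} {d : nat} (Om : set 'rV[R]_d) (p0 p1 : 'rV[R]_d -> R) (M c : R).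
Context (adm : admissible Om p0 p1 M c).
Local Notation mu := (@lebesgue_measure R).
Local Notation D := (diam Om).
Local Notation om := (omega Om p0 p1).
Local Notation v := (vfield Om p0 p1).
Hypothesis osgood : (fun eps : R => (\int[@lebesgue_measure R]_(u in `[eps, diam Om])
                      ((u + omega Om p0 p1 u)^-1)%:E)%E) @ 0^'+ --> +oo%E.
Local Notation K := (modulus Om p0 p1).
Context (x : 'rV[R]_d) (r : R).
Hypotheses (r0 : 0 < r) (Ix : inset Om r x).
Fixpoint euler (h : R) (k : nat) : 'rV[R]_d :=
  if k is k'.+1 then euler h k' + h *: v (k'%:R * h) (euler h k') else x.

(* With [th = (1 - (t + h)) / (1 - t)], the Euler step from [e] is
   [th e + (1 - th) (e + (1 - t) v)], where [e + (1 - t) v] lies in [Om]. *)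
Lemma euler_inset (h : R) (k : nat) : 0 < h -> k%:R * h <= 1 ->
  inset Om ((1 - k%:R * h) * r) (euler h k).
Proof.
move=> h0; elim: k => [|k IH]; first by rewrite mul0r subr0 mul1r.
rewrite -natr1 mulrDl mul1r => kh1.
have kh0 : 0 <= k%:R * h by rewrite mulr_ge0 // ltW.
have lt1 : 0 < 1 - k%:R * h by lra.
have {IH} Ik := IH (ltW (_ : k%:R * h < 1)).
have {}Ik : inset Om ((1 - k%:R * h) * r) (euler h k) by apply: Ik; lra.
have t01 : 0 <= k%:R * h <= 1 by apply/andP; split; lra.
have Om_m := conditional_mean_mem adm (mulr_gt0 lt1 r0) t01 Ik.
set t := k%:R * h in kh0 lt1 Ik t01 Om_m kh1 *; set e := euler h k in Ik Om_m *.
pose th := (1 - (t + h)) / (1 - t).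
have thE : th * (1 - t) = 1 - (t + h) by rewrite /th divfK // gt_eqF.
have th01 : 0 <= 1 - th <= 1.
  rewrite subr_ge0 gerBl /th ler_pdivrMr // mul1r divr_ge0 ?(ltW lt1) //; lra.
have stepE : e + h *: v t e = (1 - (1 - th)) *: e + (1 - th) *: (e + (1 - t) *: v t e).
  have hE : h = (1 - th) * (1 - t) by rewrite mulrBl mul1r thE; lra.
  apply/rowP => i; rewrite !mxE {1}hE; ring.
move=> w wr; change (Om (e + h *: v t e + w)); rewrite stepE.
(* Here the step lands exactly at time 1, where the margin is 0 and [w] must vanish. *)
have [th0|thn0] := eqVneq th 0.
  have w0 : w = 0.
    apply/eqP; rewrite -normr_le0; apply: (le_trans wr).
    by rewrite -thE th0 !mul0r.
  by rewrite w0 addr0 th0 subr0 subrr scale0r add0r scale1r.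
have thgt0 : 0 < th by rewrite lt_def thn0; move: th01; rewrite gerBl => /andP[].
(* The perturbation is carried by [e] alone: [|w| <= th * (1 - t) * r], so [th^-1 *: w] is within
   the margin of [e]. *)
rewrite addrAC (_ : _ + w = (1 - (1 - th)) *: (e + th^-1 *: w)); last first.
  by rewrite scalerDr subKr scalerA divff // scale1r.
apply: (adm_convex adm) => //; apply: Ik.
rewrite normrZ gtr0_norm ?invr_gt0 // mulrC ler_pdivrMr //.
by rewrite mulrAC [_ * th]mulrC thE.
Qed.

Lemma euler_increment (h : R) (k m : nat) (y : 'rV[R]_d) (b : R) : 0 < h ->
  (forall j, (j < m)%N -> `|v ((k + j)%:R * h) (euler h (k + j)) - y| <= b) ->
  `|euler h (k + m) - euler h k - (m%:R * h) *: y| <= m%:R * h * b.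
Proof.
move=> h0; elim: m => [|m IH] vb.
  by rewrite addn0 subrr mul0r scale0r subr0 normr0 mul0r.
have {}IH := IH (fun j jm => vb j (ltnW jm)).
have vm := vb m (ltnSn m).
rewrite addnS /= -natr1 !mulrDl mul1r.
set e := euler h (k + m) in IH vm *.
rewrite (_ : _ - _ = (e - euler h k - (m%:R * h) *: y) + h *: (v ((k + m)%:R * h) e - y)).
  rewrite (le_trans (ler_normD _ _)) // lerD // normrZ gtr0_norm // ler_pM2l //.
apply/rowP => i; rewrite !mxE; ring.
Qed.

Lemma euler_lipschitz (h : R) (k m : nat) : 0 < h ->
  `|euler h (k + m) - euler h k| <= m%:R * h * D.
Proof.
move=> h0; have := @euler_increment h k m 0 D h0.
rewrite scaler0 subr0; apply=> j _; rewrite subr0; exact: (vfield_le adm).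
Qed.

(** Within [m] steps the iterates move by at most [D * (m * h)] and time by [m * h]; together these
    give the factor [2 * D] and keep the velocity within [K lam] of its initial value. *)
Lemma euler_consistency (h rho lam : R) (k m : nat) : 0 < h -> 0 < rho -> 0 <= lam ->
  (forall j, (j <= m)%N -> (k + j)%:R * h <= 1) ->
  (forall j, (j <= m)%N -> inset Om rho (euler h (k + j))) ->
  2 * D * (m%:R * h) <= lam * rho ->
  `|euler h (k + m) - euler h k - (m%:R * h) *: v (k%:R * h) (euler h k)|
    <= m%:R * h * K lam.
Proof.
move=> h0 rho0 l0 kj1 Ikj ml; apply: euler_increment => // j jm.
have D0 := diam_gt0 adm.
have jh0 : 0 <= j%:R * h by rewrite mulr_ge0 // ltW.
have jmh : j%:R * h <= m%:R * h by rewrite ler_pM2r // ler_nat ltnW.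
have kh0 n : 0 <= n%:R * h by rewrite mulr_ge0 // ltW.
apply: (vfield_modulus adm rho0) => //.
- by rewrite kh0 kj1 // ltnW.
- by rewrite kh0; have := kj1 0%N; rewrite addn0 => ->.
- by apply: Ikj; exact: ltnW.
- by have := Ikj 0%N; rewrite addn0; apply.
apply: le_trans ml; rewrite natrD mulrDl addrAC subrr add0r ger0_norm //.
have := euler_lipschitz k j h0; nra.
Qed.

Definition mesh (n : nat) : R := n.+1%:R^-1.

Definition euler_step (n : nat) (t : R) : 'rV[R]_d :=
  euler (mesh n) (Num.truncn (t * n.+1%:R)).

Section EulerStep.
Context (n : nat).
Local Notation h := (mesh n).

Let h0 : 0 < h. Proof. by rewrite invr_gt0. Qed.

Lemma truncn_grid (t : R) : 0 <= t ->
  (Num.truncn (t * n.+1%:R))%:R * h <= t < (Num.truncn (t * n.+1%:R))%:R * h + h.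
Proof.
move=> t0; have : 0 <= t * n.+1%:R by rewrite mulr_ge0.
move=> /truncn_itv /andP[t1 t2]; apply/andP; split.
  by rewrite /mesh ler_pdivrMr.
by rewrite -[X in _ + X]mul1r -mulrDl /mesh ltr_pdivlMr // natr1.
Qed.

Lemma euler_step_inset (t : R) : 0 <= t <= 1 -> inset Om ((1 - t) * r) (euler_step n t).
Proof.
move=> /andP[t0 t1]; have /andP[g1 g2] := truncn_grid t0.
apply: inset_sub (euler_inset h0 (le_trans g1 t1)).
by rewrite ler_pM2r // lerD2l lerN2.
Qed.

Lemma euler_step_split (s t : R) : 0 <= s -> s <= t -> exists k m,
  [/\ Num.truncn (s * n.+1%:R) = k, Num.truncn (t * n.+1%:R) = (k + m)%N,
      m%:R * h <= t - s + h & t - s - h <= m%:R * h].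
Proof.
move=> s0 st; have /andP[s1 s2] := truncn_grid s0.
have /andP[t1 t2] := truncn_grid (le_trans s0 st).
set k := Num.truncn (s * _) in s1 s2 *; set l := Num.truncn (t * _) in t1 t2 *.
have kl : (k <= l)%N by apply: le_truncn; rewrite ler_wpM2r.
exists k, (l - k)%N; rewrite subnKC //; split => //; rewrite natrB // mulrBl; lra.
Qed.

Lemma euler_step_lipschitz (s t : R) : 0 <= s -> s <= t ->
  `|euler_step n t - euler_step n s| <= D * (t - s + h).
Proof.
move=> s0 st; have [k [m [sk tk m1 m2]]] := euler_step_split s0 st.
rewrite /euler_step sk tk; apply: (le_trans (euler_lipschitz k m h0)).
by rewrite mulrC ler_pM2l // (diam_gt0 adm).
Qed.

(** Three errors: the scheme between grid points ([c1]), the mismatch of at most one mesh between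
    [m * h] and [t - s] ([c2]), and the shift of the velocity from the grid time to [s] ([c3]). From
    [h <= t - s] follows [m * h <= 2 * (t - s)], hence the constant 4. *)
Lemma euler_step_consistency (T lam s t : R) :
  T < 1 -> 0 <= lam -> 0 <= s -> s < t -> t <= T -> h <= t - s ->
  4 * D * (t - s) <= lam * ((1 - T) * r) ->
  `|euler_step n t - euler_step n s - (t - s) *: v s (euler_step n s)| <=
    2 * (t - s + h) * K lam + h * D.
Proof.
move=> T1 l0 s0 st tT hst tl; have D0 := diam_gt0 adm.
have [k [m [sk tk m1 m2]]] := euler_step_split s0 (ltW st).
have rT : 0 < (1 - T) * r by rewrite mulr_gt0 // subr_gt0.
have /andP[] := truncn_grid s0; rewrite sk => k1 k2.
have /andP[] := truncn_grid (le_trans s0 (ltW st)); rewrite tk => l1 l2.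
have kh0 : 0 <= k%:R * h by rewrite mulr_ge0 // ltW.
rewrite /euler_step sk tk.
have grid j : (j <= m)%N -> (k + j)%:R * h <= T.
  move=> jm; apply: le_trans tT; apply: le_trans l1.
  by rewrite ler_pM2r // ler_nat leq_add2l.
have Ij j : (j <= m)%N -> inset Om ((1 - T) * r) (euler h (k + j)).
  move=> jm; have g := grid j jm.
  apply: inset_sub (euler_inset h0 (_ : (k + j)%:R * h <= 1)); last by lra.
  by rewrite ler_pM2r //; lra.
have Kl0 := modulus_ge0 adm l0.
have Ik : inset Om ((1 - T) * r) (euler h k) by have := Ij 0%N; rewrite addn0; apply.
have c1 : `|euler h (k + m) - euler h k - (m%:R * h) *: v (k%:R * h) (euler h k)|
    <= m%:R * h * K lam.
  apply: (euler_consistency h0 rT) => //.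
    by move=> j jm; have := grid j jm; lra.
  apply: le_trans tl.
  have : D * (m%:R * h) <= D * (2 * (t - s)) by rewrite ler_wpM2l ?(ltW D0) //; lra.
  by lra.
have c2 : `|(m%:R * h - (t - s)) *: v (k%:R * h) (euler h k)| <= h * D.
  rewrite normrZ; apply: ler_pM => //; last exact: (vfield_le adm).
  by rewrite ler_norml; apply/andP; split; lra.
have c3 : `|(t - s) *: (v (k%:R * h) (euler h k) - v s (euler h k))| <= (t - s) * K lam.
  rewrite normrZ gtr0_norm ?subr_gt0 // ler_wpM2l ?subr_ge0 ?(ltW st) //.
  apply: (vfield_modulus adm rT) => //; try by apply/andP; split; lra.
  rewrite subrr normr0 add0r distrC ger0_norm ?subr_ge0 //.
  apply: le_trans tl.
  have : D * (s - k%:R * h) <= D * (t - s) by rewrite ler_wpM2l ?(ltW D0) //; lra.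
  have := mulr_gt0 D0 (_ : 0 < t - s); rewrite subr_gt0 => /(_ st); lra.
rewrite (_ : _ - _ = (euler h (k + m) - euler h k - (m%:R * h) *: v (k%:R * h) (euler h k)) +
   ((m%:R * h - (t - s)) *: v (k%:R * h) (euler h k) +
   (t - s) *: (v (k%:R * h) (euler h k) - v s (euler h k)))).
  apply: (le_trans (ler_normD _ _)).
  apply: le_trans (lerD c1 (le_trans (ler_normD _ _) (lerD c2 c3))) _.
  have : m%:R * h * K lam <= (t - s + h) * K lam by rewrite ler_wpM2r.
  have : (t - s) * K lam <= (t - s + h) * K lam by rewrite ler_wpM2r // lerDl ltW // h0.
  lra.
apply/rowP => i; rewrite [LHS]mxE [RHS]mxE ![in RHS]mxE ![in LHS]mxE; ring.
Qed.

End EulerStep.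

End Existence.

(** * Pointwise limit of the Euler step functions *)

Section Limit.
Context {R : realType} {d : nat} (Om : set 'rV[R]_d) (p0 p1 : 'rV[R]_d -> R) (M c : R).
Context (adm : admissible Om p0 p1 M c).
Local Notation mu := (@lebesgue_measure R).
Local Notation D := (diam Om).
Local Notation om := (omega Om p0 p1).
Local Notation v := (vfield Om p0 p1).
Hypothesis osgood : (fun eps : R => (\int[@lebesgue_measure R]_(u in `[eps, diam Om])
                      ((u + omega Om p0 p1 u)^-1)%:E)%E) @ 0^'+ --> +oo%E.
Local Notation K := (modulus Om p0 p1).
Context (x : 'rV[R]_d) (r : R).
Hypotheses (r0 : 0 < r) (Ix : inset Om r x).
Local Notation euler_step := (euler_step Om p0 p1 x).
Local Notation mesh := (@mesh R).
(** Convergence along the ultrafilter is recorded only as one arbitrarily large index approximating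
    at two given times, since each estimate passed to the limit involves at most two times. *)
Lemma euler_limit : exists z : R -> 'rV[R]_d, forall (s t e : R) (n0 : nat),
  0 <= s <= 1 -> 0 <= t <= 1 -> 0 < e -> exists n,
  [/\ (n0 <= n)%N, `|euler_step n s - z s| <= e & `|euler_step n t - z t| <= e].
Proof.
have [U [UU Uoo]] := ultraFilterLemma (F := \oo) _.
have zP (t : R) : exists p : 'rV[R]_d, 0 <= t <= 1 -> euler_step n t @[n --> U] --> p.
  have [t01|nt] := boolP (0 <= t <= 1); last by exists 0.
  suff h n : Om (euler_step n t).
    by have [p _ cp] := ultra_compact_cvg UU (adm_compact adm) h; exists p.
  have /andP[t0 t1] := t01.
  apply: inset_mem (euler_step_inset adm r0 Ix n t01).
  by rewrite mulr_ge0 ?subr_ge0 // ltW.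
exists (fun t => sval (cid (zP t))) => s t e n0 s01 t01 e0.
have lim q : 0 <= q <= 1 -> U [set n | `|euler_step n q - sval (cid (zP q))| <= e].
  move=> q01; case: cid => p /= /(_ q01) cp.
  have := cp [set y | `|y - p| <= e]; apply.
  apply/nbhs_ballP; exists e => //= y; rewrite -ball_normE /= distrC; exact: ltW.
have Un0 : U [set n | (n0 <= n)%N] by apply: Uoo; exact: nbhs_infty_ge.
have [n [[h1 h2] h3]] := filter_ex (filterI (filterI Un0 (lim s s01)) (lim t t01)).
by exists n.
Qed.

Lemma closed_approx (p : 'rV[R]_d) : (forall e, 0 < e -> exists2 q, Om q & `|q - p| <= e) -> Om p.
Proof.
move=> H; apply: (adm_closed adm) => B /nbhs_ballP[e /= e0 eB].
have [q Oq qp] := H (e / 2) (divr_gt0 e0 (ltr0Sn R 1)).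
exists q; split => //; apply: eB; rewrite -ball_normE /= distrC (le_lt_trans qp) //.
by rewrite ltr_pdivrMr // ltr_pMr // ltr1n.
Qed.

Section LimitProperties.
Context (z : R -> 'rV[R]_d).
Hypothesis (zlim : forall (s t e : R) (n0 : nat),
  0 <= s <= 1 -> 0 <= t <= 1 -> 0 < e -> exists n,
  [/\ (n0 <= n)%N, `|euler_step n s - z s| <= e & `|euler_step n t - z t| <= e]).

Lemma limit_inset t : 0 <= t <= 1 -> inset Om ((1 - t) * r) (z t).
Proof.
move=> t01 w wr; apply: closed_approx => e e0.
have [n [_ zn _]] := zlim 0 t01 t01 e0.
exists (euler_step n t + w); first exact: (euler_step_inset adm r0 Ix n t01 wr).
by rewrite opprD addrACA subrr addr0.
Qed.

Lemma limit0 : z 0 = x.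
Proof.
apply/eqP; rewrite -subr_eq0 -normr_le0; apply/ler_addgt0Pr => e e0; rewrite add0r.
have z01 : 0 <= (0 : R) <= 1 by rewrite lexx ler01.
have [n [_ zn _]] := zlim 0 z01 z01 e0.
by move: zn; rewrite distrC /euler_step mul0r truncn0.
Qed.

Lemma mesh_small (e : R) : 0 < e -> exists n0, forall n, (n0 <= n)%N -> mesh n <= e.
Proof.
move=> e0; have [n0 _ H] := near_infty_natSinv_lt (PosNum e0).
by exists n0 => n nn0; apply: ltW; exact: H.
Qed.

Lemma limit_lipschitz (s t : R) : 0 <= s -> s <= t -> t <= 1 ->
  `|z t - z s| <= D * (t - s).
Proof.
move=> s0 st t1; apply/ler_addgt0Pr => e e0; have D0 := diam_gt0 adm.
have e3 : 0 < e / 3 by rewrite divr_gt0.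
have [n0 hn] := mesh_small (divr_gt0 e3 D0).
have s01 : 0 <= s <= 1 by rewrite s0 (le_trans st).
have t01 : 0 <= t <= 1 by rewrite t1 (le_trans s0).
have [n [nn0 zs zt]] := zlim n0 s01 t01 e3.
have := euler_step_lipschitz adm x n s0 st.
have := hn n nn0; rewrite ler_pdivlMr // => hD.
rewrite mulrDr => h1.
rewrite (_ : z t - z s = (euler_step n s - z s) - (euler_step n t - z t) +
  (euler_step n t - euler_step n s)); last by apply/rowP => i; rewrite !mxE; ring.
apply: (le_trans (ler_normD _ _)).
apply: (le_trans (lerD (ler_normB _ _) h1)).
have := lerD zs zt; move: hD; rewrite (mulrC (mesh n)); lra.
Qed.

Lemma limit_consistency (T lam s t : R) :
  T < 1 -> 0 < lam -> 0 <= s -> s < t -> t <= T ->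
  4 * D * (t - s) <= lam * ((1 - T) * r) ->
  `|z t - z s - (t - s) *: v s (z s)| <= 2 * (t - s) * K lam.
Proof.
move=> T1 l0 s0 st tT tl; apply/ler_addgt0Pr => e e0; have D0 := diam_gt0 adm.
have Kl := modulus_ge0 adm (ltW l0).
have e4 : 0 < e / 4 by rewrite divr_gt0.
have rT : 0 < (1 - T) * r by rewrite mulr_gt0 // subr_gt0.
have [lam' l'0 Kl'] := modulus_small adm osgood e4.
(* The entry [e / 8] serves the two endpoint errors; the other lets [vfield_modulus] with [lam'] put
   the velocities at [z s] and at its approximation within [e / 4]. *)
pose e1 := Num.min (e / 8) (lam' * ((1 - T) * r)).
have e10 : 0 < e1 by rewrite lt_min !mulr_gt0 // ?invr_gt0 // subr_gt0.
have C0 : 0 < 2 * K lam + D by rewrite ltr_wpDl // mulr_ge0.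
have st0 : 0 < t - s by rewrite subr_gt0.
(* The first entry is the condition that the mesh be at most [t - s]; the second makes the mesh
   terms [h * (2 * K lam + D)] at most [e / 4]. *)
pose e2 := Num.min (t - s) (e / 4 / (2 * K lam + D)).
have e20 : 0 < e2 by rewrite lt_min st0 !divr_gt0.
have [n0 hn] := mesh_small e20.
have s01 : 0 <= s <= 1 by apply/andP; split; lra.
have t01 : 0 <= t <= 1 by apply/andP; split; lra.
have [n [nn0 zs zt]] := zlim n0 s01 t01 e10.
have := hn n nn0; rewrite le_min => /andP[h1]; rewrite ler_pdivlMr // => h2.
have h3 := euler_step_consistency adm r0 Ix T1 (ltW l0) s0 st tT h1 tl.
move: zs zt; rewrite !le_min => /andP[zs1 zs2] /andP[zt1 _].
have inT y : inset Om ((1 - s) * r) y -> inset Om ((1 - T) * r) y.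
  by apply: inset_sub; rewrite ler_pM2r //; lra.
have vs : `|v s (euler_step n s) - v s (z s)| <= e / 4.
  apply: le_trans Kl'; apply: (vfield_modulus adm rT (ltW l'0)) => //.
  - by apply: inT; exact: (euler_step_inset adm r0 Ix).
  - by apply: inT; exact: limit_inset.
  - by rewrite subrr normr0 mulr0 addr0.
have h4 : `|(t - s) *: (v s (euler_step n s) - v s (z s))| <= e / 4.
  rewrite normrZ gtr0_norm //; apply: le_trans vs; rewrite ler_piMl //; lra.
rewrite (_ : _ - _ = (euler_step n s - z s) - (euler_step n t - z t) +
  ((euler_step n t - euler_step n s - (t - s) *: v s (euler_step n s)) +
   (t - s) *: (v s (euler_step n s) - v s (z s)))); last first.
  apply/rowP => i; rewrite [LHS]mxE [RHS]mxE ![in RHS]mxE ![in LHS]mxE; ring.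
apply: (le_trans (ler_normD _ _)).
apply: (le_trans (lerD (ler_normB _ _) (le_trans (ler_normD _ _) (lerD h3 h4)))).
have := lerD zs1 zt1; move: h2; lra.
Qed.

End LimitProperties.
End Limit.

(** * The limit solves the integral equation *)

Section LimitSolution.
Context {R : realType} {d : nat} (Om : set 'rV[R]_d) (p0 p1 : 'rV[R]_d -> R) (M c : R).
Context (adm : admissible Om p0 p1 M c).
Local Notation mu := (@lebesgue_measure R).
Local Notation D := (diam Om).
Local Notation om := (omega Om p0 p1).
Local Notation v := (vfield Om p0 p1).
Hypothesis osgood : (fun eps : R => (\int[@lebesgue_measure R]_(u in `[eps, diam Om])
                      ((u + omega Om p0 p1 u)^-1)%:E)%E) @ 0^'+ --> +oo%E.
Local Notation K := (modulus Om p0 p1).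
Context (x : 'rV[R]_d) (r : R).
Hypotheses (r0 : 0 < r) (Ix : inset Om r x).
Context (z : R -> 'rV[R]_d).
Hypothesis (z0 : z 0 = x).
Hypothesis (zin : forall t : R, 0 <= t <= 1 -> inset Om ((1 - t) * r) (z t)).
Hypothesis (zlip : forall s t : R, 0 <= s -> s <= t -> t <= 1 -> `|z t - z s| <= D * (t - s)).
Hypothesis (zcons : forall T lam s t : R, T < 1 -> 0 < lam -> 0 <= s -> s < t -> t <= T ->
  4 * D * (t - s) <= lam * ((1 - T) * r) ->
  `|z t - z s - (t - s) *: v s (z s)| <= 2 * (t - s) * K lam).
Lemma flow_modulus (T lam s t : R) : T < 1 -> 0 <= lam -> 0 <= s <= T -> 0 <= t <= T ->
  2 * D * `|t - s| <= lam * ((1 - T) * r) ->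
  `|v t (z t) - v s (z s)| <= K lam.
Proof.
move=> T1 l0 sT tT tl; have D0 := diam_gt0 adm.
have rT : 0 < (1 - T) * r by rewrite mulr_gt0 // subr_gt0.
have in01 q : 0 <= q <= T -> 0 <= q <= 1.
  by move=> /andP[-> qT] /=; apply: le_trans qT (ltW T1).
have inT q : 0 <= q <= T -> inset Om ((1 - T) * r) (z q).
  move=> qT; apply: inset_sub (zin (in01 q qT)); rewrite ler_pM2r //.
  by case/andP: qT => _; lra.
apply: (vfield_modulus adm rT l0); [exact: in01|exact: in01|exact: inT|exact: inT|].
apply: le_trans tl.
have lip : `|z t - z s| <= D * `|t - s|.
  have [st|ts] := leP s t.
    by rewrite ger0_norm ?subr_ge0 //; apply: zlip => //; [case/andP: sT|case/andP: (in01 t tT)].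
  rewrite distrC (distrC t) ger0_norm ?subr_ge0 ?(ltW ts) //.
  by apply: zlip => //; [case/andP: tT|exact: ltW|case/andP: (in01 s sT)].
lra.
Qed.

Lemma flow_continuous i : {in `]0, 1[%classic, continuous (fun s => v s (z s) 0 i)}.
Proof.
move=> s; rewrite inE /= in_itv /= => /andP[s0 s1]; have D0 := diam_gt0 adm.
apply/cvgrPdist_le => e e0; have [lam l0 Kl] := modulus_small adm osgood e0.
pose T := (1 + s) / 2; have T1 : T < 1 by rewrite /T; lra.
have rT : 0 < (1 - T) * r by rewrite mulr_gt0 // subr_gt0.
(* The first two entries keep nearby times in [[0, T]], with [T] midway between [s] and 1; the third
   is the condition of [flow_modulus]. *)
pose del := Num.min s (Num.min ((1 - s) / 2) (lam * ((1 - T) * r) / (2 * D))).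
have del0 : 0 < del by rewrite !lt_min s0 !divr_gt0 ?mulr_gt0 ?subr_gt0.
apply/nbhs_ballP; exists del => // t ts.
have : `|s - t| < del by exact: ts.
rewrite !lt_min => /and3P[h1 h2 h3].
apply: le_trans Kl; have := rV_norm_coord (v s (z s) - v t (z t)) i.
rewrite !mxE => h; apply: le_trans h _.
move: h1 h2; rewrite !ltr_norml /T => /andP[h1 h1'] /andP[h2 h2'].
apply: (flow_modulus T1 (ltW l0)).
- by apply/andP; split; rewrite /T; lra.
- by apply/andP; split; rewrite /T; lra.
by rewrite mulrC -ler_pdivlMr ?mulr_gt0 // ltW.
Qed.

Lemma flow_integrable i : mu.-integrable `[0, 1] (EFin \o (fun s => v s (z s) 0 i)).
Proof.
apply: (bounded_integrable_itv (M := D)); last by move=> s _; exact: vfield_coord_le adm _ _ _.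
apply: (@measurable_fun_itv_cc _ 0 1 false true).
apply: open_continuous_measurable_fun; first exact: interval_open.
exact: flow_continuous.
Qed.

(** The integral and the path have the same increments up to small multiples of the time step, both
    being close to [(q - s) *: v s (z s)], so [H] is constant. The margin degenerates at time 1,
    which is reached by the Lipschitz bounds. *)
Lemma flow_integral t i : 0 <= t <= 1 ->
  \int[mu]_(s in `[0, t]) v s (z s) 0 i = z t 0 i - x 0 i.
Proof.
have D0 := diam_gt0 adm.
pose H t := \int[mu]_(s in `[0, t]) v s (z s) 0 i - z t 0 i.
have H0 : H 0 = - x 0 i by rewrite /H set_itv1 Rintegral_set1 z0 sub0r.
have before1 T : 0 <= T -> T < 1 -> H T = H 0.
  move=> T0 T1; apply: small_slope_constant => // e e0.
  (* A third of [e]: the integral contributes one [K lam] and the path two. *)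
  have [lam l0 Kl] := modulus_small adm osgood (divr_gt0 e0 (ltr0Sn R 2)).
  have rT : 0 < (1 - T) * r by rewrite mulr_gt0 // subr_gt0.
  exists (lam * ((1 - T) * r) / (4 * D)); first by rewrite divr_gt0 // !mulr_gt0 // subr_gt0.
  move=> s q s0 sq qT; rewrite ler_pdivlMr ?mulr_gt0 // mulrC => hd.
  have h1 := zcons T1 l0 s0 sq qT hd.
  have q1 : q <= 1 by lra.
  have h3 : `|(z q - z s - (q - s) *: v s (z s)) 0 i| <= 2 * (q - s) * K lam.
    exact: le_trans (rV_norm_coord _ i) h1.
  move: h3; rewrite !rV_coordB rV_coordZ => h3.
  have h2 : `|\int[mu]_(y in `[0, q]) v y (z y) 0 i - \int[mu]_(y in `[0, s]) v y (z y) 0 i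
      - (q - s) * v s (z s) 0 i| <= K lam * (q - s).
    apply: Rintegral_increment => //; [exact: flow_integrable|exact: ltW|move=> y /andP[sy yq]].
    have := rV_norm_coord (v y (z y) - v s (z s)) i; rewrite rV_coordB => h.
    apply: le_trans h _; apply: (flow_modulus T1 (ltW l0)).
    - by apply/andP; split; lra.
    - by apply/andP; split; lra.
    rewrite ger0_norm ?subr_ge0 //.
    have : D * (y - s) <= D * (q - s) by rewrite ler_wpM2l ?(ltW D0) //; lra.
    have : 0 <= D * (q - s) by rewrite mulr_ge0 ?(ltW D0) //; lra.
    lra.
  rewrite /H; set I1 := Rintegral _ _ _ in h2 *; set I2 := Rintegral _ _ _ in h2 *.
  have -> : I1 - z q 0 i - (I2 - z s 0 i) = (I1 - I2 - (q - s) * v s (z s) 0 i) -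
     (z q 0 i - z s 0 i - (q - s) * v s (z s) 0 i) by ring.
  apply: (le_trans (ler_normB _ _)); apply: (le_trans (lerD h2 h3)).
  have -> : K lam * (q - s) + 2 * (q - s) * K lam = 3 * K lam * (q - s) by ring.
  rewrite ler_wpM2r //; lra.
suff HE : forall t, 0 <= t <= 1 -> H t = H 0.
  by move=> /HE; rewrite H0 /H => h; lra.
move=> {}t /andP[t0]; rewrite le_eqVlt => /orP[/eqP ->|]; last exact: before1.
apply/eqP; rewrite -subr_eq0 -normr_le0; apply/ler_addgt0Pr => e e0; rewrite add0r.
pose h := Num.min 1 (e / (2 * D)).
have h0 : 0 < h by rewrite lt_min ltr01 divr_gt0 ?mulr_gt0.
have h1 : h <= 1 by rewrite ge_min lexx.
have he : 2 * D * h <= e by rewrite mulrC -ler_pdivlMr ?mulr_gt0 // ge_min lexx orbT.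
have lo : 0 <= 1 - h by rewrite subr_ge0.
have hi : 1 - h <= 1 by rewrite gerBl ltW.
rewrite -(before1 (1 - h)) //; last by rewrite gtrBl.
have h3 := zlip lo hi (lexx 1).
have := rV_norm_coord (z 1 - z (1 - h)) i; rewrite rV_coordB => h4.
have h5 : `|\int[mu]_(y in `[0, 1]) v y (z y) 0 i - \int[mu]_(y in `[0, (1 - h)]) v y (z y) 0 i
    - (1 - (1 - h)) * 0| <= D * (1 - (1 - h)).
  apply: Rintegral_increment => //; first exact: flow_integrable.
  by move=> y _; rewrite subr0; exact: (vfield_coord_le adm).
move: h3 h4 h5; rewrite mulr0 subr0 subKr => h3 h4 h5.
rewrite /H; set I1 := Rintegral _ _ _ in h5 *; set I2 := Rintegral _ _ _ in h5 *.
have -> : I1 - z 1 0 i - (I2 - z (1 - h) 0 i) = (I1 - I2) - (z 1 0 i - z (1 - h) 0 i) by ring.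
apply: (le_trans (ler_normB _ _)); apply: (le_trans (lerD h5 (le_trans h4 h3))); lra.
Qed.

Lemma limit_cara_solution : cara_solution Om p0 p1 x z.
Proof.
split.
- move=> s /[dup] s01 /andP[s0 s1]; apply: inset_mem (zin s01).
  by rewrite mulr_ge0 ?subr_ge0 // ltW.
- move=> s /andP[s0 s1]; apply: (inset_interior (rho := (1 - s) * r)).
    by rewrite mulr_gt0 // subr_gt0.
  by apply: zin; rewrite s0 ltW.
- exact: flow_integrable.
move=> t t01; apply/rowP => i; rewrite !mxE.
have := flow_integral i t01;
rewrite (_ : Rintegral _ _ _ = Rintegral mu `[0, t] (fun s => v s (z s) 0 i)) // => ->.
by rewrite subrKC.
Qed.

End LimitSolution.

(** [Psi] is normalised to vanish at [diam Om], so [Psi(eps)] is minus the integral from [eps] to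
    [diam Om] and its divergence to [-oo] reads as that integral tending to [+oo]. Solutions are
    total functions on [R], hence uniqueness as agreement on [[0, 1]]. *)
Theorem theorem8 (R : realType) (d : nat) (Om : set 'rV[R]_d)
  (p0 p1 : 'rV[R]_d -> R) :
  (0 < d)%N ->
  compact Om -> convex_set_rV Om -> interior Om !=set0 ->
  (* p0, p1 are probability densities supported on Om *)
  (forall z, 0 <= p0 z) -> (forall z, 0 <= p1 z) ->
  (forall z, ~ Om z -> p0 z = 0) -> (forall z, ~ Om z -> p1 z = 0) ->
  lint p0 = 1 -> lint p1 = 1 ->
  (* continuous on Om *)
  {within Om, continuous p0} -> {within Om, continuous p1} ->
  (* uniformly bounded *)
  (exists M : R, forall z, p0 z <= M /\ p1 z <= M) ->
  (* bounded away from zero on Om *)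
  (exists c : R, 0 < c /\ forall z, Om z -> c <= p0 z /\ c <= p1 z) ->
  (* eta |-> omega(eta) + eta non-decreasing on [0, diam Om] *)
  (forall a b : R, 0 <= a -> a <= b -> b <= diam Om ->
     omega Om p0 p1 a + a <= omega Om p0 p1 b + b) ->
  (* Osgood-type condition: Psi(eps) -> -oo as eps -> 0+ *)
  ((fun eps : R => (\int[@lebesgue_measure R]_(u in `[eps, diam Om])
                      ((u + omega Om p0 p1 u)^-1)%:E)%E)
     @ 0^'+ --> +oo%E) ->
  forall x, interior Om x ->
  exists z : R -> 'rV[R]_d, cara_solution Om p0 p1 x z /\
    forall z' : R -> 'rV[R]_d, cara_solution Om p0 p1 x z' ->
      forall t, 0 <= t <= 1 -> z' t = z t.
Proof.
move=> d0 cO cvxO iO p00 p10 p0s p1s _ _ cp0 cp1 [M pM] [c [c0 pc]] _ osgood x Ox.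
have adm : admissible Om p0 p1 M c.
  exact: (Admissible cO cvxO iO d0 (fun z => conj (p00 z) (p10 z)) pM
    (fun z nO => conj (p0s z nO) (p1s z nO)) (conj cp0 cp1) c0 pc).
have [r r0 Ix] := interior_inset Ox.
have [z zlim] := euler_limit adm r0 Ix.
have zin := limit_inset adm r0 Ix zlim.
have zsol : cara_solution Om p0 p1 x z.
  apply: (limit_cara_solution adm osgood r0 _ zin).
  - exact: (limit0 zlim).
  - exact: (limit_lipschitz adm zlim).
  - exact: (limit_consistency adm osgood r0 Ix zlim).
exists z; split => // z' z'sol; exact: (cara_solution_unique adm osgood r0 zin zsol z'sol).
Qed.
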